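(* Let $G=G_N=(V,E)$ be finite connected undirected graphs on $N$ vertices, and assume that there are finite constants $\delta,\delta'>0$, independent of $N$, such that $\frac{\delta}{N}\le \pi_N(v)\le \frac{\delta'}{N}$ for all $v\in V$ and all $N\ge 1$. Let $\mu_N$ be the stationary distribution of the shifted IDLA process on $G\times\mathbb{Z}$. Then for any $\gamma>0$ there exists a constant $c_\gamma$, depending only on $\gamma,\delta,\delta'$, such that $$\mu_N\Big(\big\{A\in\Omega : h(A)>c_\gamma\sqrt{\tau_N}\,(\log N)^2\big\}\Big)\le N^{-\gamma}$$ for $N$ large enough.
   Context: Graph: $\mathbb{G}=G\times\mathbb{Z}$ has vertex set $\mathbb{V}=\{(v,y): v\in V,\ y\in\mathbb{Z}\}$, with $(v,y)$ adjacent to $(v',y')$ iff ($v\sim v'$ in $G$ and $y=y'$) or ($v=v'$ and $|y-y'|=1$). Level $y$ is $G\times\{y\}$, and for real $y$, $R_y=\{(v,k)\in\mathbb{V}: k\le y\}$. For $v\in V$, $\pi_N(v)=\deg v/(2|E|)$. Simple random walk on $\mathbb{G}$: a discrete-time Markov chain which at each step makes a vertical move with probability $1/2$ and a horizontal move with probability $1/2$. A vertical move goes from $(v,y)$ to $(v,y+1)$ or $(v,y-1)$ with equal probability. A horizontal move is a lazy simple random walk step on $G$: $(v,y)\to(v,y)$ with probability $1/2$ and $(v,y)\to(w,y)$ with probability $1/(2\deg v)$ for each neighbour $w$ of $v$. State space: $\Omega=\{A\subset\mathbb{V}: A=R_0\cup F\text{ for some finite }F\}$. For $A\in\Omega$,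 $h(A)=\max\{y:(v,y)\in A\text{ for some }v\in V\}$. IDLA on $\mathbb{G}$: start from a cluster $A(0)\in\Omega$ (the paper takes initial clusters connected). At each time $t\ge1$ an independent simple random walk on $\mathbb{G}$ is started at a location $(v,0)$ with $v$ sampled from $\pi_N$, and $A(t)=A(t-1)\cup\{Z_t\}$, where $Z_t$ is the first vertex outside $A(t-1)$ visited by this walk. Shifted IDLA: for $A\in\Omega$ let $k_A=\max\{k\ge0: R_k\subseteq A\}$ and let $\mathcal{S}(A)=\{(v,y-k_A):(v,y)\in A\}$. If $(A(t))_{t\ge0}$ is an IDLA process, then $A^*(t)=\mathcal{S}(A(t))$ is the associated shifted IDLA process. It is a positive recurrent Markov chain on the countable space $\Omega$, and $\mu_N$ denotes its stationary distribution. Mixing time: let $P^k_v$ be the law at time $k$ of the lazy simple random walk on $G$ (holding with probability $1/2$, otherwise moving to a uniform neighbour) started at $v$. For $\varepsilon>0$, $\tau_N(\varepsilon)=\inf\{k\ge0:\max_{v,v'\in V}\|P^k_v-P^k_{v'}\|_{TV}\le\varepsilon\}$, and $\tau_N=\tau_N(1/2)$, where $\|\mu-\nu\|_{TV}=\sup_{B}|\mu(B)-\nu(B)|$. *)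

(* Defs.v *)
From HB Require Import structures.
From mathcomp Require Export all_boot all_order all_algebra.
From mathcomp Require Export mathcomp_extra boolp classical_sets cardinality.
From mathcomp Require Export reals constructive_ereal ereal esum exp.

Set Implicit Arguments.
Unset Strict Implicit.
Unset Printing Implicit Defensive.

Export Order.TTheory GRing.Theory Num.Theory.

Local Open Scope classical_set_scope.
Local Open Scope ring_scope.

Record graph := Graph {
  vertex :> finType;
  adj : rel vertex;
  adj_sym : symmetric adj;
  adj_irr : irreflexive adj }.

Section Graph.
Variables (R : realType) (G : graph).

Definition connected_graph : Prop := forall v w : G, connect (@adj G) v w.

Definition deg (v : G) : nat := #|[set w | adj v w]%SET|.

Definition edges : {set {set G}} :=
  [set [set p.1; p.2]%SET | p in [set p : G * G | adj p.1 p.2]%SET]%SET.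

(* If G has no edge (in particular, if it has a single vertex) this is 0,
   since x / 0 = 0. *)
Definition piN (v : G) : R := (deg v)%:R / (2 * #|edges|)%:R.

Definition lazy_step (v w : G) : R :=
  2^-1 * (v == w)%:R + 2^-1 * ((adj v w)%:R / (deg v)%:R).

Fixpoint lazy_law (k : nat) (v w : G) : R :=
  if k is k'.+1 then \sum_(u : G) lazy_law k' v u * lazy_step u w
  else (v == w)%:R.

Definition tv_dist (mu nu : G -> R) : R :=
  \big[Num.max/0]_(B : {set G}) `|\sum_(v in B) mu v - \sum_(v in B) nu v|.

Definition max_tv (k : nat) : R :=
  \big[Num.max/0]_(p : G * G) tv_dist (lazy_law k p.1) (lazy_law k p.2).

(* Real-valued; the set of times is nonempty when G is connected and
   eps > 0, so that the infimum is a genuine minimum. *)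
Definition mixing_time (eps : R) : R :=
  inf [set (k%:R : R) | k in [set k : nat | max_tv k <= eps]].

Definition tauN : R := mixing_time 2^-1.

(* A vertex of G x Z is a pair (v, y) : G * int. *)
Definition cyl_step (x x' : G * int) : R :=
  2^-1 * (2^-1 * ((x.1 == x'.1) && ((x'.2 == x.2 + 1) || (x'.2 == x.2 - 1)))%:R)
  + 2^-1 * ((x.2 == x'.2)%:R * lazy_step x.1 x'.1).

Definition start_law (x : G * int) : R := piN x.1 * (x.2 == 0)%:R.

(* Probability that the walk started from start_law has s as its sequence of
   first (size s) positions. *)
Definition path_prob (s : seq (G * int)) : R :=
  if s is x :: s' then
    start_law x * \prod_(p <- zip (x :: s') s') cyl_step p.1 p.2
  else 1.

Implicit Types A B C : set (G * int).

Definition half_cyl (k : int) : set (G * int) := [set x | x.2 <= k].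

Definition Omega : set (set (G * int)) :=
  [set A | exists F, finite_set F /\ A = half_cyl 0 `|` F].

(* The greatest element of S, and 0 if there is none; for A in Omega and G
   nonempty, the maxima below exist. *)
Definition set_max (S : set int) : int := xget 0 (S `&` ubound S).

Definition height A : int := set_max [set y | exists v, A (v, y)].

Definition full_level A : int :=
  set_max [set k | 0 <= k /\ half_cyl k `<=` A].

Definition shift A : set (G * int) := [set (x.1, x.2 - full_level A) | x in A].

(* For z outside A, the probability that z is the first vertex outside A
   visited by the walk: the sum runs over the trajectories up to the exit
   from A. *)
Definition exit_law A (z : G * int) : \bar R :=
  \esum_(s in [set s : seq (G * int) | forall x, x \in s -> A x])
    (path_prob (rcons s z))%:E.

(* One-step transition probability of IDLA from A to B. *)
Definition idla_step A B : \bar R :=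
  \esum_(z in [set z | ~ A z /\ A `|` [set z] = B]) exit_law A z.

(* Probability that A(t) = B for IDLA with A(0) = A. *)
Fixpoint idla_law (t : nat) A B : \bar R :=
  if t is t'.+1 then (\esum_(C in Omega) (idla_law t' A C * idla_step C B))%E
  else (`[< A = B >]%:R)%:E.

(* Probability that A^*(t) = B for IDLA with A(0) = A. *)
Definition shifted_law (t : nat) A B : \bar R :=
  \esum_(C in [set C | Omega C /\ shift C = B]) idla_law t A C.

(* mu is the mass function of a probability on the countable set Omega;
   its values outside Omega are irrelevant. *)
Definition mass_on_Omega (mu : set (G * int) -> R) : Prop :=
  (forall A, Omega A -> 0 <= mu A) /\ \esum_(A in Omega) (mu A)%:E = 1%E.

Definition Omega_prob (mu : set (G * int) -> R) (E : set (set (G * int))) :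
    \bar R :=
  \esum_(A in Omega `&` E) (mu A)%:E.

(* If A(0) has law mu, then A^*(t) has law mu for every t. The case t = 0
   forces mu to be carried by the clusters A with shift A = A. *)
Definition shifted_idla_stationary (mu : set (G * int) -> R) : Prop :=
  mass_on_Omega mu /\
  forall t B, Omega B ->
    (\esum_(A in Omega) ((mu A)%:E * shifted_law t A B))%E = (mu B)%:E.

End Graph.

(* Main.v *)
(* Write m for the mean height of a cluster and h for its height, so that h - m
   is the number of holes below the top divided by N; let L be a constant times
   sqrt tau. A walk climbing L levels makes at least 2 tau horizontal steps with
   probability bounded below, so it enters the upper level with a law dominating
   a multiple of the uniform one. Hence a walk survives up to level Y with
   probability at most exp(- c Q / L), where Q is the sum over the levels below
   Y of the proportion of holes.

   For the growth of the top this gives E exp(a (level of the new particle - m))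
   = O(1) for all a <= c / L, because the total of Q up to the top is h - m.
   For the holes, V = sum over the vacant sites of exp(- a (level - m)) grows by a
   factor exp(a / N) at each step, and loses in mean at least (V / N) c / (L + c (h - m))
   up to a constant; when h - m is O(L log N) this beats the growth
   for a = c' / (L log N), which is where the second logarithm comes from. The
   combination V (1 + eps exp(c (h - m) / L)) therefore contracts in mean up to an
   additive constant, from every cluster. Integrating this drift inequality,
   truncated, against the stationary law bounds the tail of this function, which
   dominates eps exp(a h) since a cluster with full level 0 has a hole at level 1. *)

From mathcomp Require Import all_boot all_order all_algebra.
From mathcomp Require Import boolp classical_sets functions cardinality fsbigop.
From mathcomp Require Import filter reals constructive_ereal ereal normedtype.
From mathcomp Require Import sequences esum exp.
From mathcomp Require Import ring lra zify.
Require Import Defs.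

Set Implicit Arguments.
Unset Strict Implicit.
Unset Printing Implicit Defensive.

Local Open Scope classical_set_scope.
Local Open Scope ring_scope.

(** * Real estimates *)

Section RealBounds.
Variable R : realType.
Implicit Types x y : R.

(** The two factors of the combination depend on the same random exit level, but [V] grows by at
    most the deterministic factor exp(a / N) in one step, so it can be pulled out of the mean of the
    product. Where h - m exceeds a multiple of L log N, the loss of [V] no longer beats its growth;
    there exp(c (h - m) / L) is at least N^3 and contracts at a rate of order 1 / (L N), which wins
    despite the weight eps, of order 1 / (N log N). The walk is handled at finite horizons, where
    its exit probabilities are only subharmonic, and bounds uniform in the horizon pass to the exit
    law. A priori this law has mass at most 1; stationarity itself forces mass 1 at every cluster
    charged by mu, because the mu-mean of these masses is 1. The resulting tail bound carries a
    prefactor polynomial in log N, N and sqrt tau. A crude Poincare inequality bounds tau by a power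
    of N, so the prefactor is at most N^9 and is paid for by replacing gamma with gamma + 9 in the
    exponent. *)

Lemma expRN_le x : 0 <= x -> expR (- x) <= (1 + x)^-1.
Proof.
move=> x0; rewrite expRN lef_pV2 ?posrE ?expR_gt0 ?expR_ge1Dx//; lra.
Qed.

Lemma expR_le1D2x x : 0 <= x <= 2^-1 -> expR x <= 1 + 2 * x.
Proof.
move=> /andP[x0 x1].
have := @expR_ge1Dx R (- x); rewrite expRN => h.
have p := @expR_gt0 R x.
have : (1 - x) * expR x <= 1.
  by rewrite -[leRHS](@mulVf _ (expR x)) ?gt_eqF// ler_wpM2r// ltW.
move=> h2.
have : (1 - x) * expR x <= (1 - x) * (1 + 2 * x) by apply: le_trans h2 _; nra.
by rewrite ler_pM2l//; lra.
Qed.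

Lemma expRN_le1Bhalf x : 0 <= x <= 1 -> expR (- x) <= 1 - x / 2.
Proof.
move=> /andP[x0 x1]; apply: le_trans (expRN_le x0) _.
rewrite -div1r ler_pdivrMr; nra.
Qed.

Lemma expr1B_le x k : 0 <= x <= 1 -> (1 - x) ^+ k <= (1 + k%:R * x)^-1.
Proof.
move=> /andP[x0 x1].
have kx : 0 <= k%:R * x by rewrite mulr_ge0.
rewrite -div1r ler_pdivlMr; last lra.
elim: k {kx} => [|k IH]; first by rewrite expr0; lra.
have kx : 0 <= k%:R * x :> R by rewrite mulr_ge0.
have y0 : 0 <= (1 - x) ^+ k by rewrite exprn_ge0//; lra.
rewrite exprS -natr1 (_ : _ * _ * _ = (1 - x) ^+ k * (1 + k%:R * x)
  - (1 - x) ^+ k * (x * (k%:R * x) + x * x)); last by ring.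
by rewrite lerBlDr (le_trans IH)// lerDl mulr_ge0// addr_ge0// mulr_ge0.
Qed.

Lemma expr1B_ge x k : 0 <= x <= 1 -> 1 - k%:R * x <= (1 - x) ^+ k.
Proof.
move=> /andP[x0 x1]; elim: k => [|k IH]; first by rewrite expr0; lra.
have kx : 0 <= k%:R * x :> R by rewrite mulr_ge0.
rewrite exprS -natr1; nra.
Qed.

Lemma prodr_le1B_exp (I : Type) (s : seq I) (q : I -> R) :
  (forall i, 0 <= 1 - q i) ->
  \prod_(i <- s) (1 - q i) <= expR (- \sum_(i <- s) q i).
Proof.
move=> q1; elim: s => [|i s IH]; first by rewrite !big_nil oppr0 expR0.
rewrite !big_cons opprD expRD ler_pM ?prodr_ge0//.
by have := @expR_ge1Dx R (- q i).
Qed.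

Lemma nat_ceil x : 0 <= x -> exists k : nat, x <= k%:R <= x + 1.
Proof.
move=> x0; have c0 : 0 <= Num.ceil x by rewrite -(ler_int R) (le_trans x0)// ceil_ge.
exists `|Num.ceil x|%N; rewrite natr_absz ger0_norm// ceil_ge/=.
by have := ceilB1_lt x; rewrite intrD mulrN1z ltrBlDr => /ltW.
Qed.

End RealBounds.

(* [lazy_hit n j] is the probability that a lazy nearest-neighbour walk on the
   nonnegative integers started from [j] has hit 0 by time [n]. *)
Section LazyHitting.
Variable R : realType.

Fixpoint lazy_hit (n j : nat) : R :=
  match j, n with
  | 0%N, _ => 1
  | _, 0%N => 0
  | j'.+1, n'.+1 =>
      4^-1 * (lazy_hit n' j'.+2 + lazy_hit n' j') + 2^-1 * lazy_hit n' j'.+1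
  end.

Lemma lazy_hit0 n : lazy_hit n 0 = 1. Proof. by case: n. Qed.

Lemma lazy_hitS n j : lazy_hit n.+1 j.+1 =
  4^-1 * (lazy_hit n j.+2 + lazy_hit n j) + 2^-1 * lazy_hit n j.+1.
Proof. by []. Qed.

Lemma lazy_hit_bound n j : 0 <= lazy_hit n j <= 1.
Proof.
elim: n j => [|n IH] [|j]; rewrite ?lazy_hit0 ?lexx ?ler01//=.
have := IH j.+2; have := IH j; have := IH j.+1; lra.
Qed.

Lemma lazy_hit_nd n m j : (n <= m)%N -> lazy_hit n j <= lazy_hit m j.
Proof.
suff H k i : lazy_hit k i <= lazy_hit k.+1 i.
  by move=> /subnKC <-; elim: (m - n)%N => [|k IH]; rewrite ?addn0// addnS (le_trans IH).
elim: k i => [|k IH] [|i]; rewrite ?lazy_hit0//.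
  by have /andP[] := lazy_hit_bound 1 i.+1.
rewrite lazy_hitS [leRHS]lazy_hitS.
have := IH i.+2; have := IH i; have := IH i.+1; lra.
Qed.

(** The limits in [n] satisfy the mean value relation in [j], hence are affine in [j]; being
    nonnegative, at most 1, and equal to 1 at 0, they are constant. *)
Lemma lazy_hit_cvg1 (e : R) j : 0 < e -> exists n, 1 - e <= lazy_hit n j.
Proof.
move=> e0; pose S i := [set lazy_hit n i | n in setT].
have ubS i : ubound (S i) 1 by move=> _ [n _ <-]; case/andP: (lazy_hit_bound n i).
have neS i : S i !=set0 by exists (lazy_hit 0 i), 0%N.
have supS i : has_sup (S i) by split=> //; exists 1.
pose b i := sup (S i).
have hb n i : lazy_hit n i <= b i by apply: ub_le_sup; [exists 1|exists n].
have b1 i : b i <= 1 by apply: ge_sup.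
have b_ge0 i : 0 <= b i.
  by apply: le_trans (hb 0%N i); case/andP: (lazy_hit_bound 0 i).
have approx i (d : R) : 0 < d -> exists n, b i - d <= lazy_hit n i.
  by move=> d0; have [_ [n _ <-] /ltW] := sup_adherent d0 (supS i); exists n.
have bS i : b i.+1 = 4^-1 * (b i.+2 + b i) + 2^-1 * b i.+1.
  apply/eqP; rewrite eq_le; apply/andP; split.
    apply: ge_sup => // _ [n _ <-]; apply: (@le_trans _ _ (lazy_hit n.+1 i.+1)).
      exact: lazy_hit_nd.
    by rewrite lazy_hitS; have := hb n i.+2; have := hb n i.+1; have := hb n i; lra.
  apply/ler_addgt0Pl => d d0.
  have [n1 h1] := approx i.+2 _ d0; have [n2 h2] := approx i.+1 _ d0.
  have [n3 h3] := approx i _ d0.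
  pose n := maxn n1 (maxn n2 n3).
  have := hb n.+1 i.+1; rewrite lazy_hitS.
  have := @lazy_hit_nd n1 n i.+2 (leq_maxl _ _).
  have := @lazy_hit_nd n2 n i.+1 (leq_trans (leq_maxl _ _) (leq_maxr _ _)).
  have := @lazy_hit_nd n3 n i (leq_trans (leq_maxr _ _) (leq_maxr _ _)).
  lra.
have b0 : b 0%N = 1.
  by apply/le_anti; rewrite b1 -(lazy_hit0 0) hb.
have blin i : b i = 1 - i%:R * (1 - b 1%N).
  suff : b i = 1 - i%:R * (1 - b 1%N) /\ b i.+1 = 1 - i.+1%:R * (1 - b 1%N) by case.
  elim: i => [|i [IH1 IH2]]; first by split; [rewrite b0|]; lra.
  split=> //; have := bS i; move: IH2; rewrite IH1 -(natr1 i.+1) -(natr1 i); lra.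
have b11 : b 1%N = 1.
  apply/le_anti; rewrite b1/= leNgt; apply/negP => blt.
  have d0 : 0 < 1 - b 1%N by lra.
  have [k hk] : exists k : nat, (1 - b 1%N)^-1 < k%:R.
    exists (Num.bound (1 - b 1%N)^-1); apply: archi_boundP.
    by rewrite invr_ge0 ltW.
  have := b_ge0 k; rewrite blin.
  have : 1 < k%:R * (1 - b 1%N) by rewrite -ltr_pdivrMr// div1r.
  lra.
have [n hn] := approx j _ e0; exists n.
by apply: le_trans hn; rewrite blin b11 subrr mulr0 subr0.
Qed.

End LazyHitting.

Section BlockDecay.
Variable R : realType.

(* In the application [g k j] is the expectation of a function [u] of the walk
   at distance [j] below a level, after [k] further horizontal steps;
   [lam ^+ j] dominates the generating function at [s] of the number of
   horizontal steps made while climbing [j] levels. *)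
Lemma block_decay (g : nat -> nat -> R) (M c th s lam : R) :
  0 <= M -> 0 <= c <= 1 -> 0 <= th -> 0 <= s -> 0 <= lam ->
  4^-1 * (lam ^+ 2 + 1) + 2^-1 * s * lam <= lam ->
  (forall k j, g k j <= M) ->
  (forall k, g k 0%N <= M * (1 - c * (1 - th * s ^+ k))) ->
  (forall k j, g k j.+1 <= 4^-1 * (g k j.+2 + g k j) + 2^-1 * g k.+1 j.+1) ->
  forall k j, g k j <= M * (1 - c * (1 - th * s ^+ k * lam ^+ j)).
Proof.
move=> M0 /andP[c0 c1] th0 s0 lam0 hlam gM g0 gS.
(* Induction on the number [n] of steps of the vertical walk: when it has not reached 0 by time [n],
   only [g <= M] is used. By the inequality on [lam], the error term [th * s ^+ k * lam ^+ j] is a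
   supersolution of the recursion. Recurrence then lets [n] tend to infinity. *)
have step n k j :
    g k j <= M * (1 - c * (lazy_hit R n j - th * s ^+ k * lam ^+ j)).
  elim: n k j => [|n IH] k [|j]; rewrite ?lazy_hit0 ?expr0 ?mulr1//=.
    apply: le_trans (gM k j.+1) _; rewrite ler_peMr// sub0r mulrN opprK lerDl.
    by rewrite mulr_ge0// mulr_ge0// ?mulr_ge0// exprn_ge0.
  apply: le_trans (gS k j) _.
  have h1 := IH k j.+2; have h2 := IH k j; have h3 := IH k.+1 j.+1.
  set A := lazy_hit R n j.+2 in h1 *; set B := lazy_hit R n j in h2 *.
  set C := lazy_hit R n j.+1 in h3 *.
  have : th * s ^+ k * lam ^+ j * (4^-1 * (lam ^+ 2 + 1) + 2^-1 * s * lam)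
      <= th * s ^+ k * lam ^+ j * lam.
    by rewrite ler_wpM2l// ?mulr_ge0// exprn_ge0.
  rewrite (_ : th * s ^+ k * lam ^+ j * lam = th * s ^+ k * lam ^+ j.+1); last first.
    by rewrite exprSr; ring.
  rewrite (_ : th * s ^+ k * lam ^+ j * _ =
     4^-1 * (th * s ^+ k * lam ^+ j.+2 + th * s ^+ k * lam ^+ j)
     + 2^-1 * (th * s ^+ k.+1 * lam ^+ j.+1)); last by rewrite !exprS; ring.
  set a2 := th * s ^+ k * lam ^+ j.+2 in h1 *.
  set a0 := th * s ^+ k * lam ^+ j in h2 *.
  set a1 := th * s ^+ k.+1 * lam ^+ j.+1 in h3 *.
  set t := th * s ^+ k * lam ^+ j.+1 => ht.
  have Mc : 0 <= M * c by rewrite mulr_ge0.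
  have := ler_wpM2l Mc ht.
  rewrite !mulrDr => ht'; lra.
move=> k j; apply/ler_addgt0Pl => e e0.
have [n hn] := @lazy_hit_cvg1 R (e / (M + 1)) j (divr_gt0 e0 (ltr_wpDl M0 ltr01)).
apply: le_trans (step n k j) _.
have M10 : 0 < M + 1 by lra.
have eM : e / (M + 1) * (M + 1) = e by rewrite divfK// gt_eqF.
set d := e / (M + 1) in hn eM.
have d0 : 0 <= d by rewrite divr_ge0 ?ltW.
set t := th * _ * _; set x := lazy_hit R n j in hn *.
rewrite -subr_ge0 (_ : _ - _ = e - M * c * (1 - x)); last ring.
have : M * c * (1 - x) <= M * c * d by rewrite ler_wpM2l// ?mulr_ge0//; lra.
have : M * c * d <= M * d by rewrite ler_wpM2r// ler_piMr.
lra.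
Qed.

End BlockDecay.

(** * The drift inequality *)

Section Lyapunov.
Variable R : realType.
Variables (N ap : R).

(** Chosen so that [8 * hole_rate <= ap / (1 + ap * D)] as long as [ap * D <= 3 * ln N]. *)
Definition log_factor : R := 8 * (1 + 3 * ln N).
Definition hole_rate : R := ap / log_factor.
Definition hole_base : R := expR hole_rate.
Definition sky_weight : R := N * hole_base / (hole_base - 1).
(** Normalised by [mix_weight * (2 * ap) = hole_rate / N]: the additive error [2 * ap] in the mean
    of [expR (ap * D)] then costs no more than the other terms of the drift. *)
Definition mix_weight : R := (2 * N * log_factor)^-1.

(* [D] is the number of holes divided by [N], i.e. the height minus the mean
   height of the cluster, and [Phi] the sum of [r ^+ (depth + 1)] over the
   holes, with [r := hole_base]; [sky_weight] is the sum of the same weights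
   over all the sites above the cluster. *)
Definition hole_pot (D Phi : R) : R := expR (- hole_rate * D) * (Phi + sky_weight).
Definition lyapunov (D Phi : R) : R :=
  hole_pot D Phi * (1 + mix_weight * expR (ap * D)).

Let al := log_factor.
Let a := hole_rate.
Let r := hole_base.
Let b := sky_weight.
Let eps := mix_weight.

Hypothesis N8 : 8 <= N.
Hypothesis ap0 : 0 < ap.
Hypothesis ap8 : ap <= 8^-1.

Let N0 : 0 < N. Proof. by move: N8; lra. Qed.

Lemma log_factor_ge8 : 8 <= al.
Proof. by have : 0 <= ln N by [rewrite ln_ge0//; move: N8; lra]; rewrite /al /log_factor; lra. Qed.

Let al0 : 0 < al. Proof. have := log_factor_ge8; lra. Qed.

Lemma hole_rate_gt0 : 0 < a. Proof. exact: divr_gt0. Qed.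

Lemma hole_rateM : a * al = ap.
Proof. by rewrite /a /hole_rate divfK// gt_eqF. Qed.

Lemma hole_rate_le : 8 * a <= ap.
Proof. by rewrite -hole_rateM mulrC ler_wpM2l ?log_factor_ge8// ltW// hole_rate_gt0. Qed.

Lemma hole_base_gt : 1 + a <= r. Proof. exact: expR_ge1Dx. Qed.

Let r1 : 0 < r - 1. Proof. have := hole_base_gt; have := hole_rate_gt0; lra. Qed.

Let b_eq : b * (r - 1) = N * r.
Proof. by rewrite /b /sky_weight divfK// gt_eqF. Qed.

Lemma sky_weight_ge : N <= b.
Proof. by rewrite -(ler_pM2r r1) b_eq ler_wpM2l ?(ltW N0)//; lra. Qed.

Lemma mix_weight_gt0 : 0 < eps.
Proof. by rewrite invr_gt0 mulr_gt0 ?al0// mulr_gt0 ?N0. Qed.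

(** As [hole_rate <= ap], the factor [expR (ap * D)] compensates [expR (- hole_rate * D)], and only
    [eps] is lost. *)
Lemma lyapunov_ge (D Phi x : R) : 0 <= D -> 0 <= x -> x <= Phi + b ->
  eps * x <= lyapunov D Phi.
Proof.
move=> D0 x0 xPhi; rewrite /lyapunov /hole_pot -/eps -/a -/b.
have e0 := mix_weight_gt0.
have h : 1 <= expR (- a * D) * expR (ap * D).
  rewrite -expRD -[leLHS]expR0 ler_expR -mulrDl mulr_ge0//.
  have := hole_rate_le; have := hole_rate_gt0; lra.
have h2 : 0 <= expR (- a * D) by rewrite expR_ge0.
have P0 : 0 <= Phi + b by lra.
rewrite mulrDr mulr1 ler_wpDl ?mulr_ge0//.
rewrite [leRHS](_ : _ = eps * ((Phi + b) * (expR (- a * D) * expR (ap * D)))); last ring.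
rewrite ler_wpM2l ?(ltW e0)//; apply: le_trans xPhi _.
by rewrite ler_peMr.
Qed.

Lemma abel_sum (t : nat -> R) n : \sum_(i < n) t i * r ^+ i.+1 =
  r ^+ n * \sum_(i < n) t i - (r - 1) * \sum_(j < n) r ^+ j * \sum_(i < j) t i.
Proof.
elim: n => [|n IH]; first by rewrite !big_ord0; ring.
by rewrite !(big_ord_recr n)/= IH !exprS; ring.
Qed.

Lemma abel_sumS (t : nat -> R) n : \sum_(i < n.+1) t i * r ^+ i =
  r ^+ n * \sum_(i < n.+1) t i
  - (r - 1) * \sum_(j < n) r ^+ j * \sum_(i < j.+1) t i.
Proof.
elim: n => [|n IH]; first by rewrite !big_ord_recr !big_ord0/=; ring.
rewrite [LHS]big_ord_recr/= IH [X in _ = _ - _ * X]big_ord_recr/=.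
by rewrite [X in _ = _ * X - _]big_ord_recr/= !exprS; ring.
Qed.

Lemma geom_sum n : (r - 1) * \sum_(j < n) r ^+ j = r ^+ n - 1.
Proof.
elim: n => [|n IH]; first by rewrite big_ord0; ring.
by rewrite big_ord_recr/= mulrDr IH exprS; ring.
Qed.

(** In the application [n] is the height, [S i] the number of holes at depth [i], and [p i] the
    probability that the new particle settles at depth [i - 1]; index 0 is the level just above the
    top. *)
Variables (n : nat) (S p : nat -> R).
Hypothesis S0 : forall i, 0 <= S i.
Hypothesis p0 : forall i, 0 <= p i.
Hypothesis p1 : \sum_(i < n.+1) p i = 1.
Let D := \sum_(i < n) S i / N.
Let Phi := \sum_(i < n) S i * r ^+ i.+1.
Hypothesis tail : forall j, (j <= n)%N ->
  \sum_(i < j.+1) p i <= expR (- (ap * (D - \sum_(i < j) S i / N))).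

Let r_ge0 : 0 <= r. Proof. exact: expR_ge0. Qed.
Let D0 : 0 <= D. Proof. by apply: sumr_ge0 => i _; rewrite divr_ge0// ltW. Qed.
Let Phi0 : 0 <= Phi. Proof. by apply: sumr_ge0 => i _; rewrite mulr_ge0 ?exprn_ge0. Qed.

Let SN_le j : (j <= n)%N -> \sum_(i < j) S i / N <= D.
Proof.
move=> jn; rewrite /D -!(big_mkord xpredT (fun i => S i / N)).
rewrite [leRHS](@big_cat_nat _ _ _ j)//= lerDl sumr_ge0// => i _.
by rewrite divr_ge0// ltW.
Qed.

Let eta := ap / (1 + ap * D).

(** For [x] between 0 and [D], [expR (- (ap * x)) <= 1 / (1 + ap * x) <= 1 - eta * x]. So the
    cumulative sums of [p] lie below those of the law giving mass [1 - eta * D] to index 0 and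
    [eta * S i / N] to index [i.+1]. Summation by parts compares the means of [r ^+ i], and the
    second law gives at least [eta * Phi / N]. *)
Lemma exit_weight_ge : eta * (Phi / N) <= \sum_(i < n.+1) p i * r ^+ i.
Proof.
have [N8' N0' ap0' ap8'] := And4 N8 N0 ap0 ap8.
have apD : 0 <= ap * D by rewrite mulr_ge0// ltW.
have eta0 : 0 <= eta by rewrite divr_ge0 ?(ltW ap0)//; lra.
have etaE : eta * (1 + ap * D) = ap by rewrite divfK// gt_eqF//; lra.
have etaD : eta * D <= 1 by nra.
have hj (j : 'I_n) : \sum_(i < j.+1) p i <= 1 - eta * (D - \sum_(i < j) S i / N).
  have jn : (j <= n)%N by rewrite ltnW.
  apply: le_trans (tail jn) _.
  set x := D - _; have x0 : 0 <= x by rewrite subr_ge0 SN_le.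
  have xD : x <= D by rewrite gerBl sumr_ge0// => i _; rewrite divr_ge0// ltW.
  have apx : 0 <= ap * x by rewrite mulr_ge0// ltW.
  apply: le_trans (expRN_le apx) _.
  rewrite -div1r ler_pdivrMr; last lra.
  have : eta * (1 + ap * x) <= eta * (1 + ap * D).
    by rewrite ler_wpM2l// lerD2l ler_wpM2l// ltW.
  by rewrite etaE => h; nra.
rewrite abel_sumS p1 mulr1.
have -> : Phi / N = r ^+ n * D - (r - 1) * \sum_(j < n) r ^+ j * \sum_(i < j) S i / N.
  by rewrite -(abel_sum (fun i => S i / N)) /Phi mulr_suml; apply: eq_bigr => i _; rewrite mulrAC.
have : (r - 1) * \sum_(j < n) r ^+ j * \sum_(i < j.+1) p i <=
   (r - 1) * \sum_(j < n) r ^+ j * (1 - eta * (D - \sum_(i < j) S i / N)).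
  rewrite ler_wpM2l ?(ltW r1)// ler_sum// => j _; rewrite ler_wpM2l ?exprn_ge0//.
move=> h; rewrite lerBrDr; apply: le_trans (lerD (lexx _) h) _.
have -> d : \sum_(j < n) r ^+ j * (1 - eta * (d - \sum_(i < j) S i / N))
   = (1 - eta * d) * (\sum_(j < n) r ^+ j)
    + eta * \sum_(j < n) r ^+ j * \sum_(i < j) S i / N.
  by rewrite !mulr_sumr -big_split; apply: eq_bigr => j _ /=; ring.
have := geom_sum n; set Q := \sum_(j < n) r ^+ j => gQ.
set T := \sum_(j < n) r ^+ j * _.
rewrite [leLHS](_ : _ = eta * r ^+ n * D + (1 - eta * D) * ((r - 1) * Q)); last by ring.
by rewrite gQ; nra.
Qed.

(** Effect of a particle at index [i]. At index 0 the top rises: all depths grow by one, and the new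
    level brings [N - 1] holes of weight [r]. *)
Let D' i := D - N^-1 + (i == 0%N)%:R.
Let Phi' i := if i == 0%N then r * Phi + (N - 1) * r else Phi - r ^+ i.

(** The mean level rises by [1 / N], whence the factor [expR (a / N)]; apart from that, only the
    weight of the filled site disappears. Since the sites above the cluster are counted in [b], the
    same formula covers index 0, where a site of weight 1 is filled. *)
Lemma hole_pot_step i :
  hole_pot (D' i) (Phi' i) = expR (a / N) * (expR (- a * D) * (Phi + b - r ^+ i)).
Proof.
rewrite /hole_pot /D' /Phi' -/a -/b; case: eqP => [->|_] /=.
  rewrite (_ : - a * _ = a / N + - a * D - a); last by ring.
  rewrite !expRD expRN -/r -/(hole_base) -/r.
  have rn0 : r != 0 by rewrite gt_eqF// expR_gt0.
  rewrite -!mulrA; congr (_ * (_ * _)); apply: (mulfI rn0).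
  by rewrite mulrA mulfV// mul1r expr0; have := b_eq; lra.
rewrite addr0 (_ : - a * _ = a / N + - a * D); last by ring.
by rewrite expRD -mulrA addrAC.
Qed.

Lemma lyapunov_drift : \sum_(i < n.+1) p i * lyapunov (D' i) (Phi' i) <=
  (1 - a / N) * lyapunov D Phi + 4 * al.
Proof.
have [N8' N0' ap0' ap8'] := And4 N8 N0 ap0 ap8.
have a0 := hole_rate_gt0; have a8 := hole_rate_le; have e0 := mix_weight_gt0.
have aal := hole_rateM; have al8 := log_factor_ge8.
set V := hole_pot D Phi; set W := expR (ap * D).
have apD : 0 <= ap * D by rewrite mulr_ge0// ltW.
have W1 : 1 <= W by rewrite -[leLHS]expR0 ler_expR.
have b0 : 0 <= b by have := sky_weight_ge; lra.
have V0 : 0 <= V by rewrite /V /hole_pot mulr_ge0 ?expR_ge0// addr_ge0.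
have eta0 : 0 <= eta by rewrite divr_ge0 ?(ltW ap0)//; lra.
have etaE : eta * (1 + ap * D) = ap by rewrite divfK// gt_eqF//; lra.
have eta_ap : eta <= ap by nra.
have Ni0 : 0 < N^-1 by rewrite invr_gt0.
have NNi : N * N^-1 = 1 by rewrite mulfV// gt_eqF.
have Ni8 : N^-1 <= 8^-1 by rewrite lef_pV2 ?posrE.
set q := expR (- a * D).
have q0 : 0 < q by exact: expR_gt0.
have q1 : q <= 1 by rewrite -[leRHS]expR0 ler_expR mulNr oppr_le0 mulr_ge0// ltW.
have VE : V = q * (Phi + b) by [].
have aN : 0 <= a / N by rewrite divr_ge0 ?ltW.
set c := expR (a / N).
have c_le : c <= 1 + 2 * (a / N) by apply: expR_le1D2x; apply/andP; split=> //; nra.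
have c1 : 1 <= c by rewrite -[leLHS]expR0 ler_expR.
pose EV := \sum_(i < n.+1) p i * hole_pot (D' i) (Phi' i).
have EVE : EV = c * (V - q * \sum_(i < n.+1) p i * r ^+ i).
  rewrite /EV (eq_bigr (fun i : 'I_n.+1 =>
     c * V * p i - c * q * (p i * r ^+ i))); last first.
    by move=> i _; rewrite hole_pot_step -/c -/q VE; ring.
  by rewrite sumrB -!mulr_sumr p1; ring.
have bN : b / N * a <= 2.
  have h1 : b * a <= b * (r - 1) by rewrite ler_wpM2l// lerBrDl hole_base_gt.
  have h2 : r <= 2.
    have : r <= 1 + 2 * a by apply: (@expR_le1D2x _ a); apply/andP; split; lra.
    lra.
  by rewrite mulrAC ler_pdivrMr// (le_trans h1)// b_eq mulrC ler_pM2r.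
have EVle : EV <= V * (1 + 2 * (a / N) - eta / N) + 4 * al.
  have h1 : q * (eta * (Phi / N)) <= q * \sum_(i < n.+1) p i * r ^+ i.
    by rewrite ler_pM2l// exit_weight_ge.
  (* The sites above the cluster cause the additive constant: [eta <= ap = a * al], while
     [a * b / N <= 2]. *)
  have h2 : q * (eta * (b / N)) <= 2 * al.
    have : eta * (b / N) <= 2 * al.
      have h3 : eta * (b / N) <= al * (b / N * a).
        rewrite (_ : al * _ = ap * (b / N)); last by rewrite -aal; ring.
        by rewrite ler_wpM2r// divr_ge0// ltW.
      by apply: le_trans h3 _; rewrite mulrC ler_pM2r.
    have : 0 <= eta * (b / N) by rewrite mulr_ge0// divr_ge0// ltW.
    move=> z0 z1; apply: le_trans z1; rewrite ler_piMl//.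
  have h3 : EV <= c * (V * (1 - eta / N) + 2 * al).
    rewrite EVE ler_wpM2l//; first lra.
    have -> : V * (1 - eta / N) = V - q * (eta * (Phi / N)) - q * (eta * (b / N)).
      by rewrite VE; ring.
    lra.
  apply: le_trans h3 _.
  have etaN : 0 <= eta / N <= 1 by rewrite divr_ge0 ?(ltW N0)//=; nra.
  have h4 : c * (V * (1 - eta / N)) <= (1 + 2 * (a / N)) * (V * (1 - eta / N)).
    by rewrite ler_wpM2r// mulr_ge0//; lra.
  have h5 : V * (2 * (a / N) * (eta / N)) >= 0.
    by case/andP: etaN => eN0 _; rewrite mulr_ge0// mulr_ge0// mulr_ge0.
  have c2 : c <= 2 by nra.
  have h6 : c * (2 * al) <= 4 * al by nra.
  rewrite mulrDr; apply: le_trans (lerD h4 h6) _; lra.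
have Vle (i : 'I_n.+1) : hole_pot (D' i) (Phi' i) <= c * V.
  rewrite hole_pot_step -/c -/q VE ler_wpM2l ?(le_trans _ c1)//.
  rewrite ler_wpM2l ?(ltW q0)// gerBl exprn_ge0//.
pose EW := \sum_(i < n.+1) p i * expR (ap * D' i).
(* Only index 0 increases [D], and [tail] at [j = 0] reads [p 0 <= 1 / W]: the growth of the top
   contributes a bounded term. *)
have EWle : EW <= expR (- (ap / N)) * (W + 2 * ap).
  have -> : EW = expR (- (ap / N)) * (W * (1 + (expR ap - 1) * p 0%N)).
    rewrite /EW big_ord_recl/= /D' /= (eq_bigr (fun i : 'I_n =>
      expR (- (ap / N)) * W * p (lift ord0 i))); last first.
      move=> i _; rewrite /bump/= addr0 (_ : ap * (D - N^-1) = - (ap / N) + ap * D).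
        by rewrite expRD -/W; ring.
      by ring.
    rewrite -mulr_sumr.
    have := p1; rewrite big_ord_recl/= => pE.
    rewrite (_ : ap * _ = - (ap / N) + ap * D + ap); last by ring.
    rewrite !expRD -/W (_ : \sum_(i < n) _ = 1 - p 0%N); last by rewrite -pE; ring.
    ring.
  rewrite ler_pM2l ?expR_gt0//.
  have h0 : W * p 0%N <= 1.
    have := tail (leq0n n); rewrite big_ord_recl !big_ord0 addr0 subr0 expRN -/W => h.
    by rewrite mulrC -ler_pdivlMr ?div1r// (lt_le_trans ltr01).
  have h1 : expR ap <= 1 + 2 * ap by apply: expR_le1D2x; apply/andP; split; lra.
  have h2 : 1 <= expR ap by rewrite -[leLHS]expR0 ler_expR ltW.
  have h3 : 0 <= W * p 0%N by rewrite mulr_ge0//; lra.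
  have : (expR ap - 1) * (W * p 0%N) <= 2 * ap by nra.
  lra.
have EVW : \sum_(i < n.+1) p i * lyapunov (D' i) (Phi' i) <=
    EV + eps * V * ((1 - ap / (4 * N)) * W + 2 * ap).
  (* The pointwise bound [Vle] replaces independence of the two factors. *)
  have step1 : \sum_(i < n.+1) p i * lyapunov (D' i) (Phi' i) <= EV + eps * (c * V) * EW.
    rewrite /EV /EW mulr_sumr -big_split/=; apply: ler_sum => i _.
    rewrite /lyapunov -/eps.
    have : hole_pot (D' i) (Phi' i) * (eps * expR (ap * D' i)) <=
        c * V * (eps * expR (ap * D' i)).
      by rewrite ler_wpM2r ?Vle// mulr_ge0 ?expR_ge0// ltW.
    move=> /(ler_wpM2l (p0 i)) => h.
    rewrite mulrDr mulr1 mulrDr lerD2l; apply: le_trans h _.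
    by rewrite le_eqVlt; apply/orP; left; apply/eqP; ring.
  apply: le_trans step1 _; rewrite lerD2l.
  have h1 : c * expR (- (ap / N)) <= 1 - ap / (4 * N).
    rewrite -expRD.
    have : expR (- ((ap - a) / N)) <= 1 - (ap - a) / N / 2.
      apply: expRN_le1Bhalf; rewrite divr_ge0 ?(ltW N0)//=; last lra.
      nra.
    rewrite (_ : - ((ap - a) / N) = a / N + - (ap / N)); last by ring.
    move=> h; apply: le_trans h _; rewrite lerD2l lerN2.
    rewrite (_ : ap / (4 * N) = ap / 4 * N^-1); last by rewrite invfM; ring.
    nra.
  have h2 : c * expR (- (ap / N)) <= 1.
    apply: le_trans h1 _; rewrite gerBl divr_ge0 ?(ltW ap0)//; lra.
  have eV : 0 <= eps * V by rewrite mulr_ge0// ltW.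
  rewrite (_ : eps * (c * V) * EW = eps * V * (c * EW)); last by ring.
  rewrite ler_wpM2l//; apply: (@le_trans _ _ (c * (expR (- (ap / N)) * (W + 2 * ap)))).
    by rewrite ler_wpM2l// (le_trans ler01).
  rewrite mulrA mulrDr lerD//.
    by rewrite ler_wpM2r//; lra.
  by rewrite ler_piMl//; lra.
apply: le_trans EVW _.
have epsE : eps * (2 * ap) = a / N.
  have -> : eps = (2 * N * al)^-1 by [].
  by rewrite -aal; field; rewrite !gt_eqF.
rewrite /lyapunov -/V -/eps -/W.
have T0 : 0 <= eps * V * W by rewrite mulr_ge0 ?expR_ge0// mulr_ge0// ltW.
have -> : eps * V * ((1 - ap / (4 * N)) * W + 2 * ap) =
    eps * V * W - eps * V * W * (ap / (4 * N)) + V * (a / N).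
  by rewrite -epsE; ring.
have apN : ap / (4 * N) = ap / 4 / N by rewrite invfM; ring.
have T1 : eps * V * W * (ap / (4 * N)) >= eps * V * W * (ap / 8 / N) + eps * V * W * (a / N).
  rewrite -mulrDr apN ler_wpM2l// -mulrDl ler_pM2r//; lra.
have VaN : 0 <= V * (a / N) by rewrite mulr_ge0.
(* It remains to absorb [4 * (V * (a / N))]. For small [D] the loss of [V] does it, since
   [eta >= 8 * a]; for large [D] the contraction of [W] does. *)
have [small|big] := lerP (ap * D) (3 * ln N).
  have h8 : 8 * a <= eta.
    rewrite ler_pdivlMr; last lra.
    have apE : ap = 8 * a * (1 + 3 * ln N) by rewrite -aal /al /log_factor; ring.
    by rewrite [leRHS]apE ler_wpM2l//; lra.
  have : V * (8 * a / N) <= V * (eta / N) by rewrite ler_wpM2l// ler_wpM2r// ltW.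
  have T2 : 0 <= eps * V * W * (ap / 8 / N) by rewrite mulr_ge0// !divr_ge0// ltW.
  lra.
have VeN : 0 <= V * (eta / N) by rewrite mulr_ge0// divr_ge0// ltW.
(* The right side is [V * (a / N) * W / (16 * N)], and [W >= N ^+ 3] with [N >= 8] gives
   [W / (16 * N) >= 4]. *)
have T2 : 4 * (V * (a / N)) <= eps * V * W * (ap / 8 / N).
  have -> : eps * V * W * (ap / 8 / N) = V * W * (eps * (2 * ap)) / N / 16.
    by field; rewrite gt_eqF.
  rewrite epsE.
  have WN : N ^+ 3 <= W.
    rewrite -[N]lnK ?posrE// -expRM_natl ler_expR.
    by rewrite ltW// expRK.
  have : V * (a / N) * N ^+ 3 <= V * (a / N) * W by rewrite ler_wpM2l.
  have -> : V * W * (a / N) / N / 16 = V * (a / N) * W / N / 16 by ring.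
  move=> h; have := ler_wpM2r (ltW Ni0) h.
  have -> : V * (a / N) * N ^+ 3 * N^-1 = V * (a / N) * N ^+ 2.
    by rewrite exprSr -!mulrA NNi mulr1.
  have : V * (a / N) * 64 <= V * (a / N) * N ^+ 2.
    by rewrite ler_wpM2l//; nra.
  lra.
lra.
Qed.

End Lyapunov.

(** * Mixing of the lazy walk on the base graph *)

Section LazyWalk.
Variables (R : realType) (G : graph).
Implicit Types (v w : G) (f g : G -> R) (B : {set G}).

Lemma degE v : deg v = \sum_(w : G) (adj v w : nat).
Proof. by rewrite /deg cardsE -sum1_card big_mkcond. Qed.

Lemma sum_adj v : \sum_(w : G) (adj v w)%:R = (deg v)%:R :> R.
Proof. by rewrite degE natr_sum. Qed.

Lemma handshake : (\sum_(v : G) deg v = 2 * #|edges G|)%N.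
Proof.
pose P := [set p : G * G | adj p.1 p.2]%SET.
pose ends (p : G * G) : {set G} := [set p.1; p.2]%SET.
have -> : (\sum_(v : G) deg v = #|P|)%N.
  rewrite (eq_bigr (fun v => \sum_(w : G) (adj v w : nat))); last by move=> v _; rewrite degE.
  by rewrite pair_big/= -sum1_card [RHS]big_mkcond; apply: eq_bigr => p _; rewrite inE.
rewrite -sum1_card (partition_big_imset ends)/= -/(edges G) mulnC -sum_nat_const.
apply: eq_bigr => e /imsetP[[a b]]; rewrite inE/= => ab ->.
have ba : b != a by apply: contraTneq ab => ->; rewrite adj_irr.
rewrite sum1dep_card (_ : [set _ | _]%SET = [set (a, b); (b, a)]%SET); last first.
  apply/setP => -[x y]; rewrite !inE/= !xpair_eqE; apply/andP/orP.
    move=> [xy /eqP/setP E]; have := E x; have := E y.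
    have xny : x != y by apply: contraTneq xy => ->; rewrite adj_irr.
    rewrite !inE !eqxx ?orbT/= => /esym/orP[]/eqP yE /esym/orP[]/eqP xE; move: xny;
      rewrite xE yE ?eqxx// => _; [by right | by left].
  move=> [/andP[/eqP-> /eqP->]|/andP[/eqP-> /eqP->]]; split=> //.
    by rewrite adj_sym.
  by rewrite /ends/= finset.setUC.
by rewrite cards2 xpair_eqE eq_sym (negbTE ba).
Qed.

Hypothesis pi_gt0 : forall v, 0 < piN R v.

Let pi_ge0 v : 0 <= piN R v. Proof. exact: ltW. Qed.

Lemma deg_gt0 v : (0 < deg v)%N.
Proof.
have := pi_gt0 v; rewrite /piN; case: (deg v) => //.
by rewrite mul0r ltxx.
Qed.

Lemma edges_gt0 v : (0 < 2 * #|edges G|)%N.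
Proof.
have := pi_gt0 v; rewrite /piN; case: (2 * _)%N => //.
by rewrite invr0 mulr0 ltxx.
Qed.

Lemma sum_piN v : \sum_(w : G) piN R w = 1.
Proof.
rewrite /piN -mulr_suml -natr_sum handshake mulfV// pnatr_eq0 -lt0n.
exact: edges_gt0 v.
Qed.

Lemma pi_mean_le v f c : (forall w, f w <= c) -> \sum_(w : G) piN R w * f w <= c.
Proof.
move=> fc; have -> : c = \sum_(w : G) piN R w * c by rewrite -mulr_suml (sum_piN v) mul1r.
by apply: ler_sum => w _; rewrite ler_wpM2l.
Qed.

Lemma lazy_step_ge0 v w : 0 <= lazy_step R v w.
Proof. by rewrite /lazy_step addr_ge0// mulr_ge0// ?invr_ge0// divr_ge0. Qed.

Lemma sum_lazy_step v : \sum_(w : G) lazy_step R v w = 1.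
Proof.
rewrite /lazy_step big_split/= -!mulr_sumr -mulr_suml sum_adj.
rewrite mulfV ?pnatr_eq0 -?lt0n ?deg_gt0// (bigD1 v)//= eqxx big1 => [|w].
  by rewrite /= addr0; lra.
by rewrite eq_sym => /negbTE->.
Qed.

Lemma piN_lazy_step v w : piN R v * lazy_step R v w = piN R w * lazy_step R w v.
Proof.
rewrite /lazy_step !mulrDr; congr (_ + _).
  by rewrite (eq_sym w); case: eqP => [->|] //; rewrite !mulr0.
rewrite adj_sym /piN.
have dv : (deg v)%:R != 0 :> R by rewrite pnatr_eq0 -lt0n deg_gt0.
have dw : (deg w)%:R != 0 :> R by rewrite pnatr_eq0 -lt0n deg_gt0.
have : (2 * #|edges G|)%:R != 0 :> R by rewrite pnatr_eq0 -lt0n (edges_gt0 v).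
by move: (2 * _)%:R => e e0; field; rewrite dw e0 dv.
Qed.

Lemma lazy_law_ge0 k v w : 0 <= lazy_law R k v w.
Proof.
elim: k v w => [|k IH] v w //=; apply: sumr_ge0 => u _.
by rewrite mulr_ge0// lazy_step_ge0.
Qed.

Lemma sum_lazy_law k v : \sum_(w : G) lazy_law R k v w = 1.
Proof.
elim: k => [|k IH] /=.
  rewrite (bigD1 v)//= eqxx big1 ?addr0// => w; rewrite eq_sym => /negbTE-> //.
rewrite exchange_big/= -[RHS]IH; apply: eq_bigr => u _.
by rewrite -mulr_sumr sum_lazy_step mulr1.
Qed.

Definition lazy_op k f v : R := \sum_(w : G) lazy_law R k v w * f w.

Lemma lazy_op0 f v : lazy_op 0 f v = f v.
Proof.
rewrite /lazy_op (bigD1 v)//= eqxx mul1r big1 ?addr0// => w.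
by rewrite eq_sym => /negbTE->; rewrite mul0r.
Qed.

Lemma lazy_opS k f v : lazy_op k.+1 f v = lazy_op k (fun u => \sum_(w : G) lazy_step R u w * f w) v.
Proof.
rewrite /lazy_op /=; under eq_bigr do rewrite mulr_suml.
rewrite exchange_big/=; apply: eq_bigr => u _.
by rewrite mulr_sumr; apply: eq_bigr => w _; rewrite mulrA.
Qed.

Lemma lazy_op_add k m f v : lazy_op (k + m) f v = lazy_op k (lazy_op m f) v.
Proof.
elim: m f v => [|m IH] f v.
  by rewrite addn0; congr (lazy_op k _ v); apply/funext => u; rewrite lazy_op0.
rewrite addnS lazy_opS IH; congr (lazy_op k _ v); apply/funext => u; exact/esym/lazy_opS.
Qed.

Lemma lazy_op_le k f g v : (forall w, f w <= g w) -> lazy_op k f v <= lazy_op k g v.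
Proof. by move=> fg; apply: ler_sum => w _; rewrite ler_wpM2l ?lazy_law_ge0. Qed.

Lemma lazy_op_cst k c v : lazy_op k (fun=> c) v = c.
Proof. by rewrite /lazy_op -mulr_suml sum_lazy_law mul1r. Qed.

Lemma lazy_opD k f g v : lazy_op k (fun w => f w + g w) v = lazy_op k f v + lazy_op k g v.
Proof. by rewrite /lazy_op -big_split; apply: eq_bigr => w _ /=; rewrite mulrDr. Qed.

Lemma lazy_law_lazy_op k v w : lazy_law R k v w = lazy_op k (fun u => (u == w)%:R) v.
Proof.
rewrite /lazy_op (bigD1 w)//= eqxx mulr1 big1 ?addr0// => u /negbTE->.
by rewrite mulr0.
Qed.

Lemma lazy_law_add k m v w :
  lazy_law R (k + m) v w = \sum_(u : G) lazy_law R k v u * lazy_law R m u w.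
Proof.
rewrite lazy_law_lazy_op lazy_op_add; apply: eq_bigr => u _.
by rewrite -lazy_law_lazy_op.
Qed.

Lemma piN_lazy_law k v w :
  piN R v * lazy_law R k v w = piN R w * lazy_law R k w v.
Proof.
elim: k v w => [|k IH] v w.
  by rewrite /= (eq_sym w); case: eqP => [->|] //; rewrite !mulr0.
rewrite -[in RHS]add1n lazy_law_add !mulr_sumr /=; apply: eq_bigr => u _.
have -> : \sum_(u0 : G) (w == u0)%:R * lazy_step R u0 u = lazy_step R w u.
  by rewrite (bigD1 w)//= eqxx mul1r big1 ?addr0// => z; rewrite eq_sym => /negbTE->; rewrite mul0r.
by rewrite mulrA IH mulrAC piN_lazy_step -mulrA; ring.
Qed.

Lemma sum_piN_lazy_op k f : \sum_(v : G) piN R v * lazy_op k f v = \sum_(v : G) piN R v * f v.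
Proof.
rewrite /lazy_op; under eq_bigr do rewrite mulr_sumr.
rewrite exchange_big/=; apply: eq_bigr => w _.
under eq_bigr do rewrite mulrA piN_lazy_law mulrAC.
by rewrite -mulr_sumr sum_lazy_law mulr1.
Qed.

Definition norm2 f : R := \sum_(v : G) piN R v * f v ^+ 2.

Lemma pi_mean_sqr v f : (\sum_(w : G) piN R w * f w) ^+ 2 <= norm2 f.
Proof.
set m := \sum_(w : G) _.
have : 0 <= \sum_(w : G) piN R w * (f w - m) ^+ 2.
  by apply: sumr_ge0 => w _; rewrite mulr_ge0// sqr_ge0.
rewrite (eq_bigr (fun w => piN R w * f w ^+ 2 - 2 * m * (piN R w * f w) + m ^+ 2 * piN R w)); last by move=> w _; ring.
rewrite big_split sumrB/= -!mulr_sumr (sum_piN v) -/m /norm2; lra.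
Qed.

Definition energy f : R := \sum_(v : G) \sum_(w : G) (adj v w)%:R * (f v - f w) ^+ 2.

Lemma energy_ge0 f : 0 <= energy f.
Proof. by do 2 apply: sumr_ge0 => ? _; rewrite mulr_ge0// sqr_ge0. Qed.

(** The lazy operator is the average of the identity and the non-lazy step [S]. As [S] is a
    contraction, the squared norm is at most half of [norm2 f] plus half the scalar product of [f]
    and [S f], and the energy measures the gap between these two. *)
Lemma norm2_lazy_op1 f v0 : norm2 (lazy_op 1 f) <=
  norm2 f - energy f / (4 * (2 * #|edges G|)%:R).
Proof.
pose S v := \sum_(w : G) (adj v w)%:R / (deg v)%:R * f w.
set E := (2 * #|edges G|)%:R : R.
have E0 : 0 < E by rewrite ltr0n (edges_gt0 v0).
have piE v : piN R v = (deg v)%:R / E by [].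
clearbody E; have En0 : E != 0 by rewrite gt_eqF.
have d0 v : (deg v)%:R != 0 :> R by rewrite pnatr_eq0 -lt0n deg_gt0.
have TS v : lazy_op 1 f v = 2^-1 * f v + 2^-1 * S v.
  rewrite lazy_opS lazy_op0 /lazy_step /S mulr_sumr.
  rewrite (eq_bigr (fun w => 2^-1 * ((v == w)%:R * f w)
      + 2^-1 * ((adj v w)%:R / (deg v)%:R * f w))); last by move=> w _; ring.
  rewrite big_split/= -mulr_sumr; congr (2^-1 * _ + _).
  by rewrite (bigD1 v)//= eqxx mul1r big1 ?addr0// => w; rewrite eq_sym => /negbTE->; rewrite mul0r.
have adjsum v : \sum_(w : G) (adj v w)%:R / (deg v)%:R = 1 :> R.
  by rewrite -mulr_suml sum_adj mulfV.
(* Jensen, and invariance of [piN] under the non-lazy step *)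
have S2 : norm2 S <= norm2 f.
  have J v : S v ^+ 2 <= \sum_(w : G) (adj v w)%:R / (deg v)%:R * f w ^+ 2.
    have : 0 <= \sum_(w : G) (adj v w)%:R / (deg v)%:R * (f w - S v) ^+ 2.
      by apply: sumr_ge0 => w _; rewrite mulr_ge0 ?sqr_ge0// divr_ge0.
    rewrite (eq_bigr (fun w => (adj v w)%:R / (deg v)%:R * f w ^+ 2
      - 2 * S v * ((adj v w)%:R / (deg v)%:R * f w)
      + S v ^+ 2 * ((adj v w)%:R / (deg v)%:R))); last by move=> w _; ring.
    rewrite big_split sumrB/= -!mulr_sumr adjsum -/(S v); lra.
  have : norm2 S <= \sum_(v : G) piN R v * \sum_(w : G) (adj v w)%:R / (deg v)%:R * f w ^+ 2.
    by apply: ler_sum => v _; rewrite ler_wpM2l.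
  move=> /le_trans; apply.
  rewrite le_eqVlt; apply/orP; left; apply/eqP.
  rewrite (eq_bigr (fun v => \sum_(w : G) (adj v w)%:R / E * f w ^+ 2)); last first.
    move=> v _; rewrite mulr_sumr; apply: eq_bigr => w _; rewrite piE.
    by field; rewrite d0 En0.
  rewrite exchange_big/=; apply: eq_bigr => w _.
  rewrite -mulr_suml; congr (_ * _); rewrite -mulr_suml piE; congr (_ / _).
  by rewrite -sum_adj; apply: eq_bigr => v _; rewrite adj_sym.
have cross : energy f / E = 2 * norm2 f - 2 * \sum_(v : G) piN R v * (f v * S v).
  rewrite /energy mulr_suml.
  rewrite (eq_bigr (fun v => piN R v * f v ^+ 2 + \sum_(w : G) (adj v w)%:R / E * f w ^+ 2
      - 2 * (piN R v * (f v * S v)))); last first.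
    move=> v _; rewrite mulr_suml.
    have -> : piN R v * f v ^+ 2 = \sum_(w : G) (adj v w)%:R / E * f v ^+ 2.
      by rewrite -!mulr_suml sum_adj piE.
    rewrite /S !mulr_sumr -big_split -sumrB/=; apply: eq_bigr => w _.
    by rewrite piE; field; rewrite d0 En0.
  rewrite sumrB big_split/= -mulr_sumr exchange_big/=.
  rewrite [X in _ + X - _](_ : _ = norm2 f); first by rewrite /norm2; ring.
  apply: eq_bigr => w _; rewrite -mulr_suml; congr (_ * _).
  rewrite -mulr_suml piE; congr (_ / _).
  by rewrite -sum_adj; apply: eq_bigr => v _; rewrite adj_sym.
have -> : norm2 (lazy_op 1 f) = 4^-1 * norm2 f + 4^-1 * norm2 S
    + 2^-1 * \sum_(v : G) piN R v * (f v * S v).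
  rewrite /norm2 (eq_bigr (fun v => 4^-1 * (piN R v * f v ^+ 2)
     + 4^-1 * (piN R v * S v ^+ 2) + 2^-1 * (piN R v * (f v * S v)))).
    by rewrite !big_split/= -!mulr_sumr.
  by move=> v _; rewrite TS; field.
rewrite (_ : energy f / _ = energy f / E / 4); last by rewrite invfM; ring.
by rewrite cross; lra.
Qed.

Hypothesis G_conn : connected_graph G.
Variable N : nat.
Hypothesis cardG : #|G| = N.

(** A simple path from [v] to [w] has fewer than [N] edges, and along each of them [f] varies by at
    most the square root of the energy. *)
Lemma path_energy f v w : (f v - f w) ^+ 2 <= N%:R ^+ 2 * energy f.
Proof.
set e := energy f; have e0 : 0 <= e := energy_ge0 f.
have edge a b : adj a b -> `|f a - f b| <= Num.sqrt e.
  move=> ab; rewrite -sqrtr_sqr ler_wsqrtr// /e /energy (bigD1 a)//= (bigD1 b)//= ab mul1r.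
  rewrite -addrA lerDl addr_ge0//.
    by apply: sumr_ge0 => c _; rewrite mulr_ge0// sqr_ge0.
  by do 2 apply: sumr_ge0 => ? _; rewrite mulr_ge0// sqr_ge0.
have /connectP[p0 pp0 lp0] := G_conn v w.
have [p [pp lp szp]] : exists p, [/\ path (@adj G) v p, w = last v p & (size p < N)%N].
  case: (shortenP pp0) lp0 => p pp /card_uniqP up _ lp.
  exists p; split=> //; have : (size (v :: p) <= N)%N by rewrite -up -cardG max_card.
  by [].
have h : `|f v - f w| <= (size p)%:R * Num.sqrt e.
  rewrite {}lp; elim: p v pp {szp lp0 pp0} => [|x p IH] v /=; first by rewrite subrr normr0 mul0r.
  move=> /andP[vx /IH h].
  apply: le_trans (ler_distD (f x) _ _) _.
  by rewrite -natr1 mulrDl mul1r addrC lerD// edge.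
rewrite -[(f v - f w) ^+ 2]real_normK ?num_real// -[e](sqr_sqrtr e0) -exprMn.
rewrite ler_sqr ?nnegrE ?mulr_ge0 ?sqrtr_ge0//.
by apply: le_trans h _; rewrite ler_wpM2r ?sqrtr_ge0// ler_nat ltnW.
Qed.

Lemma edges_le v : ((2 * #|edges G|)%:R : R) <= N%:R ^+ 2.
Proof.
rewrite -handshake -natrX ler_nat -mulnn -[X in (X * _)%N]cardG -sum_nat_const.
by apply: leq_sum => w _; rewrite -cardG max_card.
Qed.

Lemma poincare f v0 : \sum_(v : G) piN R v * f v = 0 ->
  norm2 f <= N%:R ^+ 2 * energy f.
Proof.
move=> f0; apply: (pi_mean_le v0) => v.
have -> : f v = \sum_(w : G) piN R w * (f v - f w).
  under eq_bigr do rewrite mulrBr.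
  by rewrite sumrB f0 subr0 -mulr_suml (sum_piN v) mul1r.
apply: le_trans (pi_mean_sqr v (fun w => f v - f w)) _.
by apply: (pi_mean_le v0) => w; exact: path_energy.
Qed.

(** The rate combines the Poincare constant [N ^ 2] with the factor [4 * (2 * #|edges G|)], at most
    [4 * N ^ 2]. *)
Lemma norm2_lazy_op k f v0 : \sum_(v : G) piN R v * f v = 0 ->
  norm2 (lazy_op k f) <= (1 - (4 * N%:R ^+ 4)^-1) ^+ k * norm2 f.
Proof.
move=> f0; have N0 : 0 < N%:R :> R.
  by rewrite ltr0n -cardG; apply/card_gt0P; exists v0.
have n0 : 0 <= norm2 f by apply: sumr_ge0 => v _; rewrite mulr_ge0 ?sqr_ge0.
have c0 : 0 <= 1 - (4 * N%:R ^+ 4)^-1 :> R.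
  have : 1 <= N%:R ^+ 4 :> R by rewrite exprn_ege1// ler1n -(ltr0n R).
  move=> h; rewrite subr_ge0 invf_le1//; lra.
elim: k => [|k IH].
  by rewrite expr0 mul1r (_ : lazy_op 0 f = f)//; apply/funext => v; rewrite lazy_op0.
rewrite exprS -mulrA; apply: le_trans (ler_wpM2l c0 IH).
set g := lazy_op k f.
have g0 : \sum_(v : G) piN R v * g v = 0 by rewrite sum_piN_lazy_op.
have -> : lazy_op k.+1 f = lazy_op 1 g.
  by apply/funext => v; rewrite -add1n lazy_op_add.
apply: le_trans (norm2_lazy_op1 g v0) _.
rewrite mulrBl mul1r lerD2l lerN2.
have e0 := energy_ge0 g.
set E := (2 * #|edges G|)%:R; have EN : E <= N%:R ^+ 2 := edges_le v0.
have E0 : 0 < E by rewrite ltr0n (edges_gt0 v0).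
have P := poincare v0 g0.
rewrite mulrC ler_pdivrMr; last by rewrite mulr_gt0// exprn_gt0.
apply: le_trans P _.
rewrite [leRHS]mulrAC ler_pdivlMr; last by lra.
have N2 : 0 <= N%:R ^+ 2 * energy g by rewrite mulr_ge0.
have := ler_wpM2l N2 EN; rewrite (exprD _ 2 2); lra.
Qed.

Variable delta : R.
Hypothesis delta0 : 0 < delta.
Hypothesis pi_ge : forall v, delta / N%:R <= piN R v.

(** Passing from the mean square to the value at [v] costs [1 / piN R v <= N / delta]; with the rate
    [1 / (4 * N ^ 4)] and the decay [1 / (1 + k * x)] this is where [N ^ 5] comes from. *)
Lemma lazy_op_mixing (k : nat) B v :
  64 * N%:R ^+ 5 / delta <= k%:R ->
  `|lazy_op k (fun w => (w \in B)%:R) v - \sum_(w in B) piN R w| <= 4^-1.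
Proof.
move=> hk; set m := \sum_(w in B) _.
pose f w : R := (w \in B)%:R - m.
have N1 : 1 <= N%:R :> R by rewrite ler1n -cardG; apply/card_gt0P; exists v.
have mE : m = \sum_(w : G) piN R w * (w \in B)%:R.
  by rewrite /m big_mkcond; apply: eq_bigr => w _; case: ifP; rewrite ?mulr1 ?mulr0.
have f0 : \sum_(v : G) piN R v * f v = 0.
  rewrite /f; under eq_bigr do rewrite mulrBr.
  by rewrite sumrB -mE -mulr_suml (sum_piN v) mul1r subrr.
have m01 : 0 <= m <= 1.
  rewrite sumr_ge0//= -(sum_piN v) [leRHS](bigID (mem B))/= lerDl.
  exact: sumr_ge0.
have -> : lazy_op k (fun w => (w \in B)%:R) v - m = lazy_op k f v.
  by rewrite /f (lazy_opD k (fun w => (w \in B)%:R) (fun=> - m)) lazy_op_cst.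
have f1 : norm2 f <= 1.
  rewrite -(sum_piN v); apply: ler_sum => w _; rewrite ler_piMr//.
  by rewrite /f; case: (w \in B); rewrite /=; nra.
have h := norm2_lazy_op k v f0.
set x := (4 * N%:R ^+ 4)^-1 in h.
have N4 : 1 <= N%:R ^+ 4 :> R by rewrite exprn_ege1.
have x01 : 0 <= x <= 1 by rewrite invr_ge0 invf_le1; lra.
have hx := expr1B_le k x01.
have pk : piN R v * lazy_op k f v ^+ 2 <= (1 + k%:R * x)^-1.
  apply: (@le_trans _ _ (norm2 (lazy_op k f))).
    rewrite /norm2 (bigD1 v)//= lerDl sumr_ge0// => w _.
    by rewrite mulr_ge0 ?sqr_ge0.
  apply: le_trans h _; apply: le_trans hx.
  by rewrite ler_piMr// exprn_ge0//; lra.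
have kx : 16 * N%:R / delta <= 1 + k%:R * x.
  have : 64 * N%:R ^+ 5 / delta * x <= k%:R * x by rewrite ler_wpM2r//; lra.
  rewrite (_ : 64 * N%:R ^+ 5 / delta * x = 16 * N%:R / delta); first lra.
  by rewrite /x; field; rewrite !gt_eqF//; lra.
have pkd : delta / N%:R * lazy_op k f v ^+ 2 <= (16 * N%:R / delta)^-1.
  apply: le_trans (ler_wpM2r (sqr_ge0 _) (pi_ge v)) _; apply: le_trans pk _.
  rewrite lef_pV2// posrE; first by apply: lt_le_trans kx; rewrite divr_gt0//; lra.
  by rewrite divr_gt0//; lra.
have sq : lazy_op k f v ^+ 2 <= 16^-1.
  have dN : 0 < delta / N%:R by rewrite divr_gt0//; lra.
  rewrite -(ler_pM2l dN); apply: le_trans pkd _.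
  rewrite le_eqVlt; apply/orP; left; apply/eqP; field; rewrite !gt_eqF//; lra.
rewrite -(@ler_pXn2r _ 2) ?nnegrE// real_normK ?num_real//; apply: le_trans sq _; lra.
Qed.

Lemma sum_law_lazy_op k B v :
  \sum_(w in B) lazy_law R k v w = lazy_op k (fun w => (w \in B)%:R) v.
Proof.
by rewrite /lazy_op big_mkcond; apply: eq_bigr => w _; case: ifP; rewrite ?mulr1 ?mulr0.
Qed.

Lemma max_tv_small (k : nat) : 64 * N%:R ^+ 5 / delta <= k%:R ->
  max_tv R G k <= 2^-1.
Proof.
move=> hk; apply: bigmax_le => [|[v w] _]; first lra.
apply: bigmax_le => [|B _ /=]; first lra.
have := lazy_op_mixing B v hk; have := lazy_op_mixing B w hk.
rewrite !sum_law_lazy_op; set a := lazy_op _ _ w; set b := lazy_op _ _ v; set m := \sum_(_ in _) _.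
by rewrite !ler_norml => /andP[? ?] /andP[? ?]; apply/andP; split; lra.
Qed.

(** The infimum is attained, so the walk is mixed at time [tauN] itself; the polynomial bound later
    absorbs powers of [sqrt tauN] into a power of [N]. *)
Lemma tauN_spec (v0 : G) : exists k : nat, [/\ tauN R G = k%:R, max_tv R G k <= 2^-1
  & (k%:R : R) <= 64 * N%:R ^+ 5 / delta + 1].
Proof.
pose x := 64 * N%:R ^+ 5 / delta.
have x0 : 0 <= x by rewrite divr_ge0 ?mulr_ge0 ?exprn_ge0// ltW.
have [k0 /andP[hk0 k0x]] := nat_ceil x0.
have ex : exists k, max_tv R G k <= 2^-1 by exists k0; exact: max_tv_small.
case: (ex_minnP ex) => k hk kmin; exists k; split=> //; last first.
  by apply: le_trans k0x; rewrite ler_nat kmin// max_tv_small.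
apply/eqP; rewrite eq_le; apply/andP; split.
  apply: ge_inf; last by exists k.
  by exists 0 => _ [m _ <-].
apply: lb_le_inf; first by exists k%:R, k.
by move=> _ [m hm <-]; rewrite ler_nat kmin.
Qed.

(** At time 0 two distinct vertices are at total variation distance 1. *)
Lemma tauN_ge1 : (2 <= N)%N -> 1 <= tauN R G.
Proof.
move=> N2.
have [v [w vw]] : exists v w : G, v != w.
  move: N2; rewrite -cardG => /card_gt1P[v [w [_ _ vw]]]; by exists v, w.
have [[|k] [-> h _]] := tauN_spec v; last by rewrite ler1n.
exfalso.
have : tv_dist (lazy_law R 0 v) (lazy_law R 0 w) <= 2^-1.
  by apply: le_trans h; rewrite /max_tv; exact: (@le_bigmax _ _ _ 0 _ (v, w)).
have : `|\sum_(u in [set v]%SET) lazy_law R 0 v u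
     - \sum_(u in [set v]%SET) lazy_law R 0 w u| <= tv_dist (lazy_law R 0 v) (lazy_law R 0 w).
  by rewrite /tv_dist; exact: (@le_bigmax _ _ _ 0 _ [set v]%SET).
rewrite !big_set1/= eqxx (eq_sym w) (negbTE vw) subr0 normr1; lra.
Qed.

Lemma tv_overlap k v w : max_tv R G k <= 2^-1 ->
  2^-1 <= \sum_(u : G) Num.min (lazy_law R k v u) (lazy_law R k w u).
Proof.
move=> h.
pose B := [set u | lazy_law R k w u <= lazy_law R k v u]%SET.
have h1 : `|\sum_(u in B) lazy_law R k v u - \sum_(u in B) lazy_law R k w u| <= 2^-1.
  apply: le_trans h; apply: (@le_trans _ _ (tv_dist (lazy_law R k v) (lazy_law R k w))).
    by rewrite /tv_dist; exact: (@le_bigmax _ _ _ 0 _ B).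
  by rewrite /max_tv; exact: (@le_bigmax _ _ _ 0 _ (v, w)).
have h2 := sum_lazy_law k v.
rewrite (bigID (mem B))/= in h2.
rewrite (bigID (mem B))/=.
have -> : \sum_(i in B) Num.min (lazy_law R k v i) (lazy_law R k w i) =
    \sum_(i in B) lazy_law R k w i.
  by apply: eq_bigr => u; rewrite inE => ?; rewrite min_r.
have -> : \sum_(i | i \notin B) Num.min (lazy_law R k v i) (lazy_law R k w i) =
    \sum_(i | i \notin B) lazy_law R k v i.
  by apply: eq_bigr => u; rewrite inE -ltNge => /ltW ?; rewrite min_l.
by move: h1; rewrite ler_norml => /andP[? ?]; lra.
Qed.

(* Reversibility and Cauchy-Schwarz: the sum over [u] of [min^2 / pi] is at
   least [(\sum_u min)^2 >= 1/4]. *)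
Lemma lazy_law_double k v w : max_tv R G k <= 2^-1 ->
  piN R w / 4 <= lazy_law R (k + k) v w.
Proof.
move=> h; have ov := tv_overlap v w h.
have rev u : lazy_law R k u w = piN R w * (lazy_law R k w u / piN R u).
  by rewrite mulrA -piN_lazy_law mulrC mulKf// gt_eqF.
rewrite lazy_law_add.
under eq_bigr do rewrite rev mulrCA.
rewrite -mulr_sumr ler_pM2l//.
have : \sum_(u : G) (Num.min (lazy_law R k v u) (lazy_law R k w u) - piN R u / 4)
   <= \sum_(u : G) lazy_law R k v u * (lazy_law R k w u / piN R u).
  apply: ler_sum => u _; set x := lazy_law R k v u; set y := lazy_law R k w u.
  have x0 : 0 <= x := lazy_law_ge0 _ _ _; have y0 : 0 <= y := lazy_law_ge0 _ _ _.
  have p := pi_gt0 u; set q := piN R u in p *.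
  rewrite mulrA ler_pdivlMr//.
  have m0 : 0 <= Num.min x y by rewrite le_min x0.
  have mx : Num.min x y <= x by rewrite ge_min lexx.
  have my : Num.min x y <= y by rewrite ge_min lexx orbT.
  have mm : Num.min x y * Num.min x y <= x * y by rewrite ler_pM.
  set m := Num.min x y in m0 mx my mm *.
  have : 0 <= (m - q / 2) ^+ 2 by rewrite sqr_ge0.
  by rewrite sqrrB; lra.
rewrite sumrB -mulr_suml (sum_piN v).
by move=> h2; apply: le_trans h2; lra.
Qed.

Lemma lazy_law_minor k j v w : max_tv R G k <= 2^-1 -> (k + k <= j)%N ->
  piN R w / 4 <= lazy_law R j v w.
Proof.
move=> h /subnK <-; rewrite lazy_law_add.
have -> : piN R w / 4 = \sum_(u : G) lazy_law R (j - (k + k)) v u * (piN R w / 4).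
  by rewrite -mulr_suml sum_lazy_law mul1r.
by apply: ler_sum => u _; rewrite ler_wpM2l ?lazy_law_ge0// lazy_law_double.
Qed.

End LazyWalk.

(** * Survival probabilities on the cylinder *)

Section BlockConstants.
Variable R : realType.

(** Exponential Markov inequality for the number of horizontal steps made while climbing:
    [th * s ^+ m] is at least 1 for [m < 2 * k], and [lam ^+ j] dominates the mean of [s ^+ m] over
    a climb of [j] levels. So a climb of [L] levels makes fewer than [2 * k] horizontal steps with
    probability at most 1/2. *)
Lemma block_constants (k : nat) : (1 <= k)%N ->
  exists (L : nat) (s th lam : R),
  [/\ (1 <= L)%N, (L%:R : R) <= 30 * Num.sqrt k%:R,
      [/\ 0 <= s <= 1, 0 <= th & th * s ^+ (k + k) = 1]
    & [/\ 0 <= lam <= 1, th * lam ^+ L <= 2^-1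
      & 4^-1 * (lam ^+ 2 + 1) + 2^-1 * s * lam <= lam]].
Proof.
move=> k1; pose K := (k + k)%:R : R.
have kR : 1 <= k%:R :> R by rewrite ler1n.
have KE : K = 2 * k%:R by rewrite /K natrD; lra.
have K2 : 2 <= K by lra.
have K0 : 0 < K by lra.
pose q := Num.sqrt K; have q2 : q ^+ 2 = K by rewrite sqr_sqrtr// ltW.
have q0 : 0 <= q := sqrtr_ge0 K.
have q1 : 1 <= q by rewrite -(ler_pXn2r (ltn0Sn 1)) ?nnegrE// expr1n q2; lra.
have qk : q <= 2 * Num.sqrt k%:R.
  rewrite -(ler_pXn2r (ltn0Sn 1)) ?nnegrE ?mulr_ge0 ?sqrtr_ge0// q2 exprMn sqr_sqrtr ?KE; lra.
(* With [lam = 1 - y] and [s = 1 - 4 * y ^+ 2] the inequality on [lam] becomes [y <= 7 / 8]. Then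
   [L * y >= 7] gives [lam ^+ L <= 1 / 8], against [th <= 4]. *)
pose y := (2 * q)^-1.
have y0 : 0 < y by rewrite invr_gt0; lra.
have y1 : y <= 2^-1 by rewrite lef_pV2 ?posrE; lra.
have yq : 2 * q * y = 1 by rewrite mulfV// gt_eqF//; lra.
have Ky : K^-1 = 4 * y ^+ 2.
  by rewrite -q2 /y; field; rewrite gt_eqF//; lra.
have Ki : 0 <= K^-1 <= 1 by rewrite invr_ge0 ltW//= invf_le1//; lra.
have [L /andP[L1 L2]] := @nat_ceil R (14 * q) (mulr_ge0 (ler0n _ _) q0).
pose s := 1 - K^-1.
have sK : 4^-1 <= s ^+ (k + k).
  rewrite exprD; have h := expr1B_ge k Ki.
  have : k%:R * K^-1 = 2^-1 by rewrite KE; field; rewrite gt_eqF//; lra.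
  rewrite -/s in h; nra.
exists L, s, (s ^+ (k + k))^-1, (1 - y); split.
- by rewrite -(ler_nat R); lra.
- lra.
- split; [rewrite /s; lra | rewrite invr_ge0; lra | rewrite mulVf// gt_eqF//; lra].
split; first lra.
  have y01 : 0 <= y <= 1 by lra.
  have := expr1B_le L y01.
  have : (1 + L%:R * y)^-1 <= 8^-1 by rewrite lef_pV2 ?posrE; nra.
  set z := (1 - y) ^+ L => h1 h2.
  rewrite ler_pdivrMl; lra.
rewrite /s Ky; nra.
Qed.

End BlockConstants.

Section CylinderWalk.
Variables (R : realType) (G : graph).
Implicit Types (v w : G) (x : G * int) (f g u : G * int -> R) (A : set (G * int)).

Definition cyl_op f x : R :=
  4^-1 * (f (x.1, x.2 + 1) + f (x.1, x.2 - 1))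
  + 2^-1 * \sum_(w : G) lazy_step R x.1 w * f (w, x.2).

(* Contribution of the trajectories leaving [A] at time [n] exactly
   (resp. at most [n]) to the expectation of [f] at the exit point. *)
Fixpoint exit_at A f n x : R :=
  match n with
  | 0%N => if `[< A x >] then 0 else f x
  | n'.+1 => if `[< A x >] then cyl_op (exit_at A f n') x else 0
  end.

Fixpoint exit_by A f n x : R :=
  match n with
  | 0%N => if `[< A x >] then 0 else f x
  | n'.+1 => if `[< A x >] then cyl_op (exit_by A f n') x else f x
  end.

Lemma cyl_op_le f g x : (forall y, f y <= g y) -> cyl_op f x <= cyl_op g x.
Proof.
move=> fg; rewrite /cyl_op lerD// ler_wpM2l ?invr_ge0//; first by rewrite lerD.
by apply: ler_sum => w _; rewrite ler_wpM2l// lazy_step_ge0.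
Qed.

Lemma cyl_opD f g x : cyl_op (fun y => f y + g y) x = cyl_op f x + cyl_op g x.
Proof.
rewrite /cyl_op (eq_bigr (fun w : G => lazy_step R x.1 w * f (w, x.2)
    + lazy_step R x.1 w * g (w, x.2))); last by move=> w _; rewrite mulrDr.
by rewrite big_split/=; ring.
Qed.

Lemma cyl_op0 x : cyl_op (fun=> 0) x = 0.
Proof. by rewrite /cyl_op big1 => [|w _]; rewrite ?mulr0// !addr0 mulr0. Qed.

Lemma exit_byE A f n x : exit_by A f n x = \sum_(k < n.+1) exit_at A f k x.
Proof.
elim: n x => [|n IH] x; first by rewrite big_ord_recl big_ord0 addr0.
rewrite big_ord_recl /=; case: asboolP => _; last by rewrite big1 ?addr0.
rewrite add0r (_ : exit_by A f n = fun x => \sum_(k < n.+1) exit_at A f k x); last first.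
  exact/funext.
elim: n.+1 => [|m IHm]; first by rewrite big_ord0 -[RHS](cyl_op0 x); congr (cyl_op _ _); apply/funext => y; rewrite big_ord0.
rewrite big_ord_recr/= -IHm -cyl_opD; congr (cyl_op _ _); apply/funext => y.
by rewrite big_ord_recr.
Qed.

Lemma exit_by_le_super A f n x : (forall x, 0 <= f x) ->
  (forall x, A x -> cyl_op f x <= f x) -> exit_by A f n x <= f x.
Proof.
move=> f0 fA; elim: n x => [|n IH] x /=; case: asboolP => // Ax.
by apply: le_trans (fA x Ax); apply: cyl_op_le.
Qed.

Lemma exit_at_ge0 A f n x : (forall x, 0 <= f x) -> 0 <= exit_at A f n x.
Proof.
move=> f0; elim: n x => [|n IH] x /=; case: asboolP => // _.
by rewrite -(cyl_op0 x); apply: cyl_op_le.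
Qed.

Lemma exit_by_ge0 A f n x : (forall x, 0 <= f x) -> 0 <= exit_by A f n x.
Proof. by move=> f0; rewrite exit_byE sumr_ge0// => k _; exact: exit_at_ge0. Qed.

Lemma exit_by_nd A f n x : (forall x, 0 <= f x) ->
  exit_by A f n x <= exit_by A f n.+1 x.
Proof. by move=> f0; rewrite !exit_byE [leRHS]big_ord_recr lerDl exit_at_ge0. Qed.

(** One more step of the walk only adds exits; at a fixed horizon harmonicity holds in this
    direction. *)
Lemma exit_by_sub A f n x : (forall x, 0 <= f x) -> A x ->
  exit_by A f n x <= cyl_op (exit_by A f n) x.
Proof.
move=> f0 Ax; apply: le_trans (exit_by_nd A n x f0) _ => /=.
by case: asboolP.
Qed.

Hypothesis pi_gt0 : forall v, 0 < piN R v.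
Variable N : nat.
Hypothesis cardG : #|G| = N.
Variable delta : R.
Hypothesis delta0 : 0 < delta.
Hypothesis pi_ge : forall v, delta / N%:R <= piN R v.

Lemma cyl_op1 x : cyl_op (fun=> 1) x = 1.
Proof.
rewrite /cyl_op (eq_bigr (lazy_step R x.1)); last by move=> w _; rewrite mulr1.
by rewrite (sum_lazy_step pi_gt0); lra.
Qed.

Lemma sum_piN_step (v0 : G) (h : G -> R) :
  \sum_(v : G) piN R v * \sum_(w : G) lazy_step R v w * h w = \sum_(v : G) piN R v * h v.
Proof.
rewrite -(sum_piN_lazy_op pi_gt0 1 h); apply: eq_bigr => v _.
by rewrite lazy_opS lazy_op0.
Qed.

Definition level_holes A (l : int) : {set G} := [set v | ~~ `[< A (v, l) >]]%SET.
Definition hole_density A (l : int) : R := #|level_holes A l|%:R / N%:R.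

Lemma hole_density_bound A l (v0 : G) : 0 <= hole_density A l <= 1.
Proof.
have N0 : 0 < N%:R :> R by rewrite ltr0n -cardG; apply/card_gt0P; exists v0.
by rewrite divr_ge0//= ler_pdivrMr// mul1r ler_nat -cardG max_card.
Qed.

Lemma delta_le1 (v0 : G) : delta <= 1.
Proof.
have N0 : 0 < N%:R :> R by rewrite ltr0n -cardG; apply/card_gt0P; exists v0.
rewrite -(sum_piN pi_gt0 v0); have -> : delta = \sum_(v : G) delta / N%:R.
  by rewrite sumr_const cardG -[RHS]mulr_natr divfK// gt_eqF.
exact: ler_sum.
Qed.

Lemma pi_holes_ge A l : delta * hole_density A l <= \sum_(v in level_holes A l) piN R v.
Proof.
rewrite /hole_density mulrCA mulr_natl -sumr_const; exact: ler_sum.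
Qed.

Variables (A : set (G * int)) (Y n : nat).
Let f x : R := (Y%:Z <= x.2)%R%:R.
(** Probability of leaving [A] within [n] steps at a level at least [Y], that is, of having missed
    all the holes below [Y]. *)
Let u := exit_by A f n.
Let f0 x : 0 <= f x. Proof. by rewrite /f ler0n. Qed.

Lemma tail_bound01 x : 0 <= u x <= 1.
Proof.
rewrite exit_by_ge0//=.
suff : exit_by A f n x <= exit_by A (fun=> 1) n x.
  by move=> /le_trans; apply; apply: exit_by_le_super => // y _; rewrite cyl_op1.
elim: n x => [|m IH] x /=; case: asboolP => // _; rewrite /f ?lern1 ?leq_b1//.
exact: cyl_op_le.
Qed.

(** At a hole below [Y] the function [u] vanishes, so subharmonicity extends from [A] to all sites
    below [Y]. *)
Lemma tail_sub x : x.2 < Y%:Z -> u x <= cyl_op u x.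
Proof.
move=> xY; have [Ax|nA] := pselect (A x); first exact: exit_by_sub.
have -> : u x = 0.
  rewrite /u; case: n => [|m] /=; case: asboolP => // _; by rewrite /f leNgt xY.
by rewrite -(cyl_op0 x); apply: cyl_op_le => y; case/andP: (tail_bound01 y).
Qed.

Lemma tail_hole v l : l < Y%:Z -> v \in level_holes A l -> u (v, l) = 0.
Proof.
rewrite inE => lY; rewrite /u; case: n => [|m] /=; case: asboolP => // _ _;
  by rewrite /f leNgt/= lY.
Qed.

(** All lower levels are included because the walk may go down before it climbs. *)
Let M (l : nat) : R := sup [set u x | x in [set x | x.2 <= l%:Z]].

Lemma tail_le_sup l x : x.2 <= l%:Z -> u x <= M l.
Proof.
move=> xl; apply: ub_le_sup; last by exists x.
by exists 1 => _ [y _ <-]; case/andP: (tail_bound01 y).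
Qed.

Lemma tail_le_supB (l j : nat) v : u (v, l%:Z - j%:Z) <= M l.
Proof. by apply: tail_le_sup => /=; lia. Qed.

Lemma tail_subB (l j : nat) v : (l < Y)%N -> u (v, l%:Z - j.+1%:Z) <=
  4^-1 * (u (v, l%:Z - j%:Z) + u (v, l%:Z - j.+2%:Z))
  + 2^-1 * \sum_(w : G) lazy_step R v w * u (w, l%:Z - j.+1%:Z).
Proof.
move=> lY; have h : l%:Z - j.+1%:Z < Y%:Z by clear -lY; lia.
have := @tail_sub (v, l%:Z - j.+1%:Z) h; rewrite /cyl_op/=.
have -> : l%:Z - j.+1%:Z + 1 = l%:Z - j%:Z by clear; lia.
by have -> : l%:Z - j.+1%:Z - 1 = l%:Z - j.+2%:Z by clear; lia.
Qed.

Lemma tail_sup_le l c (v0 : G) : (forall x, x.2 <= l%:Z -> u x <= c) -> M l <= c.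
Proof.
move=> h; apply: ge_sup; first by exists (u (v0, 0)), (v0, 0).
by move=> _ [x xl <-]; exact: h.
Qed.

Lemma tail_sup_bound l (v0 : G) : 0 <= M l <= 1.
Proof.
apply/andP; split; last by apply: tail_sup_le => // x _; case/andP: (tail_bound01 x).
by apply: le_trans (@tail_le_sup l (v0, 0) _) => //; case/andP: (tail_bound01 (v0, 0)).
Qed.

Lemma tail_sup_nd l m (v0 : G) : (l <= m)%N -> M l <= M m.
Proof.
move=> lm; apply: tail_sup_le => // x xl; apply: tail_le_sup.
by apply: le_trans xl _; rewrite lez_nat.
Qed.

Let p := \sum_(v : G) piN R v * u (v, 0).

(* The starting law is invariant for the horizontal motion, so the first [L]
   levels are controlled as well. *)
Lemma start_level (l : nat) (v0 : G) : (l < Y)%N ->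
  p <= M l * (1 - delta * hole_density A l).
Proof.
move=> lY; set B := level_holes A l.
have /andP[M0 M1] := tail_sup_bound l v0.
pose b := \sum_(v in B) piN R v.
have b01 : 0 <= b <= 1.
  rewrite sumr_ge0 => [|v _]; last exact: ltW.
  rewrite -(sum_piN pi_gt0 v0) [leRHS](bigID (mem B))/= lerDl.
  by apply: sumr_ge0 => v _; exact: ltW.
(* By invariance of [piN], [g] does not depend on the number [k] of horizontal steps: [block_decay]
   applies without error term, with [th = 0] and [s = lam = 1]. *)
pose g (k j : nat) := \sum_(v : G) piN R v * u (v, l%:Z - j%:Z).
have gM k j : g k j <= M l.
  apply: (pi_mean_le pi_gt0 v0) => v; exact: tail_le_supB.
have g0 k : g k 0%N <= M l * (1 - b * (1 - 0 * 1 ^+ k)).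
  rewrite mul0r subr0 mulr1 /g.
  rewrite (bigID (mem B))/= big1 ?add0r => [|v vB]; last first.
    by rewrite subr0 tail_hole ?mulr0.
  have -> : 1 - b = \sum_(v | v \notin B) piN R v.
    by rewrite -(sum_piN pi_gt0 v0) (bigID (mem B))/= -/b; ring.
  rewrite mulr_sumr; apply: ler_sum => v _; rewrite mulrC ler_wpM2r ?(ltW (pi_gt0 v))//.
  by exact: tail_le_supB.
have gS k j : g k j.+1 <= 4^-1 * (g k j.+2 + g k j) + 2^-1 * g k.+1 j.+1.
  have : g k j.+1 <= \sum_(v : G) (4^-1 * (piN R v * u (v, l%:Z - j%:Z))
     + 4^-1 * (piN R v * u (v, l%:Z - j.+2%:Z))
     + 2^-1 * (piN R v * \sum_(w : G) lazy_step R v w * u (w, l%:Z - j.+1%:Z))).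
    apply: ler_sum => v _.
    have := ler_wpM2l (ltW (pi_gt0 v)) (tail_subB j v lY).
    by move=> /le_trans; apply; rewrite le_eqVlt; apply/orP; left; apply/eqP; ring.
  rewrite !big_split/= -!mulr_sumr (sum_piN_step v0 (fun w => u (w, _))) => h.
  by apply: le_trans h _; rewrite /g le_eqVlt; apply/orP; left; apply/eqP; ring.
have h1 : 4^-1 * (1 ^+ 2 + 1) + 2^-1 * 1 * 1 <= 1 :> R by rewrite expr1n; lra.
have := block_decay M0 b01 (lexx 0) ler01 ler01 h1 gM g0 gS 0 l.
rewrite mul0r mul0r subr0 mulr1 {1}/g subrr -/p => /le_trans; apply.
by rewrite ler_wpM2l// lerD2l lerN2; exact: pi_holes_ge.
Qed.

Variables (K L : nat) (s th lam : R).
Hypothesis minor : forall j v w, (K <= j)%N -> piN R w / 4 <= lazy_law R j v w.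
Hypothesis s01 : 0 <= s <= 1.
Hypothesis th0 : 0 <= th.
Hypothesis thsK : th * s ^+ K = 1.
Hypothesis lam01 : 0 <= lam <= 1.
Hypothesis thlam : th * lam ^+ L <= 2^-1.
Hypothesis lam_sub : 4^-1 * (lam ^+ 2 + 1) + 2^-1 * s * lam <= lam.
Hypothesis L1 : (1 <= L)%N.

Lemma sup_level (l : nat) (v0 : G) : (l + L < Y)%N ->
  M l <= M (l + L)%N * (1 - delta / 8 * hole_density A (l + L)%:Z).
Proof.
move=> lY; set m := (l + L)%N in lY *; set B := level_holes A m.
have /andP[M0 M1] := tail_sup_bound m v0.
have /andP[q0 q1] := hole_density_bound A m v0.
have d1 := delta_le1 v0.
have [d0' th0' /andP[s0 s1]] := And3 delta0 th0 s01.
have /andP[lam0 lam1] := lam01.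
set q := hole_density A m in q0 q1 *; pose c := delta / 4 * q.
have c01 : 0 <= c <= 1 by rewrite /c; nra.
have /andP[c0 c1] := c01.
apply: tail_sup_le => // -[v y] /= yl.
pose g (k j : nat) := \sum_(w : G) lazy_law R k v w * u (w, m%:Z - j%:Z).
have gM k j : g k j <= M m.
  rewrite -(lazy_op_cst pi_gt0 k (M m) v); apply: lazy_op_le => w.
  by exact: tail_le_supB.
have g0 k : g k 0%N <= M m * (1 - c * (1 - th * s ^+ k)).
  apply: (@le_trans _ _ (M m * (1 - \sum_(w in B) lazy_law R k v w))).
    rewrite /g (bigID (mem B))/= big1 ?add0r => [|w wB]; last first.
      by rewrite subr0 tail_hole ?mulr0.
    have -> : 1 - \sum_(w in B) lazy_law R k v w = \sum_(w | w \notin B) lazy_law R k v w.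
      by rewrite -(sum_lazy_law pi_gt0 k v) (bigID (mem B))/=; ring.
    rewrite mulr_sumr; apply: ler_sum => w _; rewrite mulrC ler_wpM2r ?lazy_law_ge0//.
    by exact: tail_le_supB.
  rewrite ler_wpM2l// lerD2l lerN2.
  (* Before [K] horizontal steps the bound is trivial, as [th * s ^+ k >= 1]; afterwards [minor]
     gives a hole of level [m] probability at least a quarter of its stationary mass. *)
  have [kK|Kk] := ltnP k K.
    apply: (@le_trans _ _ 0); last by apply: sumr_ge0 => w _; exact: lazy_law_ge0.
    rewrite mulr_ge0_le0// subr_le0 -thsK ler_wpM2l// ler_wiXn2l// ltnW//.
  apply: (@le_trans _ _ c).
    by rewrite ler_piMr// gerBl mulr_ge0// exprn_ge0.
  apply: (@le_trans _ _ (\sum_(w in B) piN R w / 4)); last first.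
    by apply: ler_sum => w _; exact: minor.
  rewrite -mulr_suml; have := pi_holes_ge A m; rewrite -/q -/B /c; lra.
have gS k j : g k j.+1 <= 4^-1 * (g k j.+2 + g k j) + 2^-1 * g k.+1 j.+1.
  have -> : g k.+1 j.+1 = \sum_(w : G) lazy_law R k v w
      * \sum_(z : G) lazy_step R w z * u (z, m%:Z - j.+1%:Z).
    exact: (@lazy_opS _ _ k (fun z => u (z, m%:Z - j.+1%:Z))).
  have : g k j.+1 <= \sum_(w : G) (4^-1 * (lazy_law R k v w * u (w, m%:Z - j%:Z))
     + 4^-1 * (lazy_law R k v w * u (w, m%:Z - j.+2%:Z))
     + 2^-1 * (lazy_law R k v w * \sum_(z : G) lazy_step R w z * u (z, m%:Z - j.+1%:Z))).
    apply: ler_sum => w _.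
    have := ler_wpM2l (lazy_law_ge0 R k v w) (tail_subB j w lY).
    by move=> /le_trans; apply; rewrite le_eqVlt; apply/orP; left; apply/eqP; ring.
  rewrite !big_split/= -!mulr_sumr => h.
  by apply: le_trans h _; rewrite /g le_eqVlt; apply/orP; left; apply/eqP; ring.
pose j := `|m%:Z - y|%N.
have jE : j%:Z = m%:Z - y by rewrite /j /m; clear -yl; lia.
have Lj : (L <= j)%N by rewrite /j /m; clear -yl; lia.
have := block_decay M0 c01 th0 s0 lam0 lam_sub gM g0 gS 0 j.
rewrite expr0 mulr1.
have -> : g 0%N j = u (v, y).
  rewrite /g jE subKr; exact: (lazy_op0 (fun w => u (w, y))).
move=> /le_trans; apply; rewrite ler_wpM2l// lerD2l lerN2.
(* The error is at most 1/2, which turns [delta / 4] into [delta / 8]. *)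
have : th * lam ^+ j <= th * lam ^+ L by rewrite ler_wpM2l// ler_wiXn2l.
move=> /le_trans/(_ thlam)/(ler_wpM2l c0).
have : delta / 8 * q = c / 2 by rewrite /c; field.
lra.
Qed.

(* [sup_level] compares levels [L] apart, so the products [W t] of [L]
   consecutive suprema telescope, and [p ^+ L] is at most a product over all
   the levels. *)
Lemma exit_above_le (v0 : G) :
  p <= expR (- (delta / 8 / L%:R * \sum_(i < Y.-1) hole_density A i.+1%:Z)).
Proof.
have d1 := delta_le1 v0; have d0 := delta0.
have M0 l : 0 <= M l by case/andP: (tail_sup_bound l v0).
have M1 l : M l <= 1 by case/andP: (tail_sup_bound l v0).
(* Extended by 0 from level [Y] on, so that [start] and [next] hold for every [i]. *)
pose q (i : nat) : R := if (i.+1 < Y)%N then hole_density A i.+1%:Z else 0.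
have q01 i : 0 <= q i <= 1.
  by rewrite /q; case: ifP => _; rewrite ?hole_density_bound ?lexx ?ler01.
pose c := delta / 8.
have cq i : 0 <= 1 - c * q i <= 1 by have := q01 i; rewrite /c; nra.
have p_le l : p <= M l by apply: (pi_mean_le pi_gt0 v0) => v; apply: tail_le_sup.
have p0 : 0 <= p.
  by apply: sumr_ge0 => v _; rewrite mulr_ge0 ?(ltW (pi_gt0 v))//; case/andP: (tail_bound01 (v, 0)).
have start i : p <= (1 - c * q i) * M i.+1.
  rewrite /q; case: ifP => iY; last by rewrite mulr0 subr0 mul1r.
  apply: le_trans (start_level v0 iY) _; rewrite mulrC ler_wpM2r//.
  have /andP[h0 _] := hole_density_bound A i.+1%:Z v0.
  by rewrite lerD2l lerN2 /c; nra.
have next i : M i.+1 <= (1 - c * q (i + L)%N) * M (i.+1 + L)%N.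
  rewrite /q -addSn; case: ifP => iY; first by rewrite mulrC; exact: sup_level.
  by rewrite mulr0 subr0 mul1r; apply: tail_sup_nd => //; rewrite leq_addr.
pose W t := \prod_(i < L) M (t + i)%N.+1.
have W01 t : 0 <= W t <= 1.
  rewrite prodr_ge0//=; apply: prodr_ile1 => i _; by rewrite M0 M1.
have Wstep t : W t <= (1 - c * q (t + L)%N) * W t.+1.
  rewrite /W; case: L L1 next => // L' _ next.
  rewrite big_ord_recl big_ord_recr/= addn0 mulrCA mulrA.
  rewrite [X in _ <= X](_ : _ = (1 - c * q (t + L'.+1)) * M (t.+1 + L')%N.+1 *
     \prod_(i < L') M (t.+1 + i)%N.+1); last by ring.
  rewrite (eq_bigr (fun i : 'I_L' => M (t.+1 + i)%N.+1)); last first.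
    by move=> i _; rewrite /bump/= add1n addnS addSn.
  rewrite ler_wpM2r ?prodr_ge0//; have := next t.
  by rewrite (_ : t.+1 + L'.+1 = (t.+1 + L')%N.+1)%N// addnS.
have Wmany T : W 0%N <= \prod_(t < T) (1 - c * q (t + L)%N) * W T.
  elim: T => [|T IH]; first by rewrite big_ord0 mul1r.
  rewrite big_ord_recr/= -mulrA; apply: le_trans IH _; rewrite ler_wpM2l//.
  by apply: prodr_ge0 => i _; case/andP: (cq (i + L)%N).
have pL : p ^+ L <= \prod_(i < L + Y) (1 - c * q i).
  rewrite big_split_ord/= -[L in X in X <= _]card_ord -prodr_const.
  apply: (@le_trans _ _ (\prod_(i < L) ((1 - c * q i) * M i.+1))).
    by apply: ler_prod => i _; rewrite p0 start.
  rewrite big_split/= ler_wpM2l//.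
    by apply: prodr_ge0 => i _; case/andP: (cq i).
  apply: le_trans (Wmany Y) _.
  rewrite (eq_bigr (fun i : 'I_Y => 1 - c * q (L + i)%N)); last first.
    by move=> i _; rewrite addnC.
  rewrite ler_piMr//; last by case/andP: (W01 Y).
  by apply: prodr_ge0 => i _; case/andP: (cq (L + i)%N).
have L0 : 0 < L%:R :> R by rewrite ltr0n.
rewrite -(@ler_pXn2r _ L)// ?nnegrE ?expR_ge0//.
apply: le_trans pL _.
apply: le_trans (prodr_le1B_exp _ _) _; first by move=> i; case/andP: (cq i).
rewrite -expRM_natl ler_expR mulrN lerN2 mulrA [leLHS](_ : _ =
    c * \sum_(i < Y.-1) hole_density A i.+1%:Z); last first.
  by congr (_ * _); rewrite -/c mulrCA mulfV ?mulr1// gt_eqF.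
rewrite -mulr_sumr ler_wpM2l//; first by rewrite /c; lra.
have h : (Y.-1 <= L + Y)%N by rewrite (leq_trans (leq_pred _))// leq_addl.
rewrite (big_ord_widen _ (fun i => hole_density A i.+1%:Z) h) big_mkcond/=.
apply: ler_sum => i _; case: ifP => iY.
  by rewrite /q -ltn_predRL iY.
by case/andP: (q01 i).
Qed.

End CylinderWalk.

(** * The exit law *)

Section EsumFacts.
Variable R : realType.
Local Open Scope ereal_scope.

Lemma esumZl (T : choiceType) (X : set T) (a : T -> \bar R) (c : R) :
  (0 <= c)%R -> (forall x, 0 <= a x) ->
  \esum_(x in X) (c%:E * a x) = c%:E * \esum_(x in X) a x.
Proof.
move=> c0 a0; have [->|cn0] := eqVneq c 0%R.
  by rewrite mul0e esum1// => x _; rewrite mul0e.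
have c_gt0 : (0 < c)%R by rewrite lt_neqAle eq_sym cn0.
have le (d : R) (b : T -> \bar R) : (0 < d)%R -> (forall x, 0 <= b x) ->
    \esum_(x in X) (d%:E * b x) <= d%:E * \esum_(x in X) b x.
  move=> d0 b0; apply: ge_ereal_sup => _ [F [finF FX] <-].
  rewrite -ge0_mule_fsumr//.
  by rewrite lee_pmul2l// ereal_sup_ubound//; exists F.
apply/eqP; rewrite eq_le le//=.
rewrite -lee_pdivlMl//.
have -> : \esum_(x in X) a x = \esum_(x in X) (c^-1%:E * (c%:E * a x)).
  by apply: eq_esum => x _; rewrite muleA -EFinM mulVf// mul1e.
by rewrite le ?invr_gt0// => x; rewrite mule_ge0.
Qed.

Lemma esum_fiber (T1 T2 : choiceType) (X : set T1) (Y : set T2) (phi : T1 -> T2)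
    (a : T1 -> \bar R) :
  (forall x, X x -> Y (phi x)) -> (forall x, X x -> 0 <= a x) ->
  \esum_(y in Y) \esum_(x in [set x | X x /\ phi x = y]) a x = \esum_(x in X) a x.
Proof.
move=> XY a0; rewrite (esum_esum (a := fun _ => a)); last by move=> y x _ [Xx _]; exact: a0.
rewrite (@reindex_esum _ _ _ X _ (fun x => (phi x, x)))//; split.
- by move=> x Xx /=; split=> //; exact: XY.
- by move=> x x' _ _ [].
- by move=> [y x] /= [_ [Xx <-]]; exists x.
Qed.

Lemma esum_delta (T : choiceType) (x0 : T) (c : R) : (0 <= c)%R ->
  \esum_(x in [set: T]) ((x == x0)%:R * c)%:E = c%:E.
Proof.
move=> c0; rewrite (esumID [set x0])//; last first.
  by move=> x _; rewrite lee_fin mulr_ge0.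
rewrite setTI esum_set1 ?lee_fin ?mulr_ge0// eqxx mul1r esum1 ?adde0// => x [_ /= /eqP].
by move=> /negbTE ->; rewrite mul0r.
Qed.

End EsumFacts.

Section ExitLaw.
Variables (R : realType) (G : graph).
Implicit Types (v w : G) (x z : G * int) (f g : G * int -> R) (s : seq (G * int)).

Lemma cyl_step_ge0 x z : 0 <= cyl_step R x z.
Proof.
by rewrite /cyl_step addr_ge0// mulr_ge0// ?invr_ge0// mulr_ge0// lazy_step_ge0.
Qed.

Lemma cyl_stepE f x z : cyl_step R x z * f z =
  (z == (x.1, x.2 + 1))%:R * (4^-1 * f (x.1, x.2 + 1))
  + (z == (x.1, x.2 - 1))%:R * (4^-1 * f (x.1, x.2 - 1))
  + \sum_(w : G) (z == (w, x.2))%:R * (2^-1 * (lazy_step R x.1 w * f (w, x.2))).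
Proof.
case: x z => v y [v' y']; rewrite /cyl_step !xpair_eqE /=.
have -> : \sum_(w : G) ((v' == w) && (y' == y))%:R * (2^-1 * (lazy_step R v w * f (w, y)))
    = (y == y')%:R * (2^-1 * (lazy_step R v v' * f (v', y'))).
  rewrite (bigD1 v')//= eqxx big1 ?addr0 => [|w]; last first.
    by rewrite eq_sym => /negbTE ->; rewrite mul0r.
  by rewrite (eq_sym y'); case: eqP => [->|] //; rewrite !mul0r.
rewrite (eq_sym v); case: (eqVneq v' v) => [->|_] /=; last by ring.
case: (eqVneq y' (y + 1)) => [->|_] /=.
  have -> : (y + 1 == y - 1)%:R = 0 :> R by case: eqP => //; lia.
  by field.
case: (eqVneq y' (y - 1)) => [->|_] /=; last by ring.
by field.
Qed.

Lemma esum_cyl_step f x : (forall z, 0 <= f z) ->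
  \esum_(z in [set: G * int]) (cyl_step R x z * f z)%:E = (cyl_op f x)%:E.
Proof.
move=> f0.
have h0 z a : 0 <= f a -> 0 <= ((z == a :> G * int)%:R * (4^-1 * f a))%R.
  by move=> fa; rewrite mulr_ge0// mulr_ge0// invr_ge0.
have h1 z w : 0 <= (z == (w, x.2) :> G * int)%:R * (2^-1 * (lazy_step R x.1 w * f (w, x.2))).
  by rewrite mulr_ge0// mulr_ge0 ?invr_ge0// mulr_ge0// lazy_step_ge0.
under eq_esum do rewrite cyl_stepE !EFinD -sumEFin.
rewrite esumD; last 2 first.
- by move=> z _; rewrite adde_ge0// lee_fin h0.
- by move=> z _; apply: sume_ge0 => w _; rewrite lee_fin h1.
rewrite esumD; [|by move=> z _; rewrite lee_fin h0..].
rewrite !esum_delta ?mulr_ge0 ?invr_ge0//.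
rewrite esum_sum; last by move=> z w _ _; rewrite lee_fin h1.
under eq_bigr => w _ do rewrite esum_delta ?mulr_ge0 ?invr_ge0// ?lazy_step_ge0//.
by rewrite sumEFin -!EFinD /cyl_op mulr_sumr mulrDr.
Qed.

Definition walk_weight x s : R := \prod_(p <- zip (x :: s) s) cyl_step R p.1 p.2.

Lemma walk_weight_cons x z s :
  walk_weight x (z :: s) = cyl_step R x z * walk_weight z s.
Proof. by rewrite /walk_weight /= big_cons. Qed.

Lemma walk_weight_ge0 x s : 0 <= walk_weight x s.
Proof. by apply: prodr_ge0 => p _; exact: cyl_step_ge0. Qed.

Lemma path_prob_cons x s : path_prob R (x :: s) = start_law R x * walk_weight x s.
Proof. by []. Qed.

Variables (A : set (G * int)) (f : G * int -> R).
Hypothesis f0 : forall x, 0 <= f x.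

Let inside (n : nat) := [set s | size s = n /\ forall x, x \in s -> A x].

Lemma esum_cons (n : nat) (a : seq (G * int) -> \bar R) :
  (forall s, 0 <= a s)%E ->
  \esum_(s in inside n.+1) a s = \esum_(x in A) \esum_(s in inside n) a (x :: s).
Proof.
move=> a0; rewrite (esum_esum (a := fun x s => a (x :: s)))//.
rewrite (@reindex_esum _ _ _ (A `*`` (fun=> inside n)) _ (fun p => p.1 :: p.2))//; split.
- move=> [x s] /= [Ax [<- sA]]; split=> // y.
  by rewrite inE => /orP[/eqP->//|/sA].
- by move=> [x s] [y t] _ _ /= [-> ->].
- move=> [|x s] [] //= [sn] sA; exists (x, s) => //=; split.
    by apply: sA; rewrite mem_head.
  by split=> // y ys; apply: sA; rewrite inE ys orbT.
Qed.

Lemma esum_walk_weight n x :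
  \esum_(s in inside n) \esum_(z in ~` A) (walk_weight x (rcons s z) * f z)%:E
  = (cyl_op (exit_at A f n) x)%:E.
Proof.
have w0 t z : (0 <= (walk_weight x (rcons t z) * f z)%:E)%E.
  by rewrite lee_fin mulr_ge0// walk_weight_ge0.
elim: n x {w0} => [|n IH] x.
  rewrite (_ : inside 0 = [set [::]]); last first.
    by apply/seteqP; split=> [s /= [/size0nil ->]|s /= ->].
  rewrite esum_set1; last first.
    by apply: esum_ge0 => z _; rewrite lee_fin mulr_ge0// walk_weight_ge0.
  rewrite -esum_cyl_step; last by move=> z; exact: exit_at_ge0.
  rewrite esum_mkcond; apply: eq_esum => z _ /=.
  have [Az|Az] := pselect (A z).
    by rewrite memNset//= asboolT// mulr0.
  by rewrite mem_set//= asboolF// /walk_weight /= big_seq1.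
rewrite esum_cons; last first.
  by move=> s; apply: esum_ge0 => z _; rewrite lee_fin mulr_ge0// walk_weight_ge0.
rewrite -esum_cyl_step; last by move=> z; exact: exit_at_ge0.
rewrite esum_mkcond; apply: eq_esum => y _.
have [Ay|Ay] := pselect (A y); last by rewrite memNset//= asboolF// mulr0.
rewrite mem_set//= asboolT// EFinM -IH -esumZl ?cyl_step_ge0//; last first.
  by move=> s; apply: esum_ge0 => z _; rewrite lee_fin mulr_ge0// walk_weight_ge0.
apply: eq_esum => s _; rewrite -esumZl ?cyl_step_ge0//; last first.
  by move=> z; rewrite lee_fin mulr_ge0// walk_weight_ge0.
by apply: eq_esum => z _; rewrite walk_weight_cons -EFinM mulrA.
Qed.

Lemma start_law_ge0 x : 0 <= start_law R x.
Proof. by rewrite /start_law mulr_ge0// /piN divr_ge0. Qed.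

Lemma path_prob_ge0 s : 0 <= path_prob R s.
Proof.
case: s => [|x s]; first exact: ler01.
by rewrite path_prob_cons mulr_ge0 ?start_law_ge0// walk_weight_ge0.
Qed.

Lemma exit_law_ge0 z : (0 <= exit_law R A z)%E.
Proof. by apply: esum_ge0 => s _; rewrite lee_fin path_prob_ge0. Qed.

Lemma esum_start_law (g : G * int -> R) : (forall x, 0 <= g x) ->
  \esum_(x in [set: G * int]) (start_law R x * g x)%:E
  = (\sum_(v : G) piN R v * g (v, 0))%:E.
Proof.
move=> g0; rewrite -sumEFin.
have p0 v : 0 <= piN R v by rewrite /piN divr_ge0.
under [RHS]eq_bigr => v _ do rewrite -(@esum_delta _ _ (v, 0 : int)) ?mulr_ge0//.
rewrite -esum_sum; last by move=> x v _ _; rewrite lee_fin !mulr_ge0.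
apply: eq_esum => -[v y] _; rewrite sumEFin; congr (_%:E).
rewrite /start_law/= (bigD1 v)//= xpair_eqE eqxx big1 ?addr0 => [|w]; last first.
  by rewrite xpair_eqE eq_sym => /negbTE ->; rewrite mul0r.
by case: eqP => [->|_] /=; rewrite ?mulr0 ?mul0r// mulr1 mul1r.
Qed.

Hypothesis A0 : half_cyl (G := G) 0 `<=` A.

(** Sorting the trajectories by length turns the left side into the series of the means of
    [exit_at], whose partial sums are the means of [exit_by]. *)
Lemma exit_law_le (B : R) :
  (forall n, \sum_(v : G) piN R v * exit_by A f n (v, 0) <= B) ->
  (\esum_(z in ~` A) (exit_law R A z * (f z)%:E) <= B%:E)%E.
Proof.
move=> hB.
have pf s z : (0 <= (path_prob R (rcons s z) * f z)%:E)%E.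
  by rewrite lee_fin mulr_ge0// path_prob_ge0.
have -> : \esum_(z in ~` A) (exit_law R A z * (f z)%:E)%E
    = \esum_(s in [set s : seq (G * int) | forall x, x \in s -> A x])
        \esum_(z in ~` A) (path_prob R (rcons s z) * f z)%:E.
  rewrite esum_esum//.
  rewrite (@reindex_esum _ _ _ ((~` A) `*`` (fun=> [set s : seq (G * int) | forall x, x \in s -> A x])) _
    (fun p => (p.2, p.1)))/=; last first.
    split=> [[z s] [/= ? ?]|[z s] [z' s'] _ _ [-> ->]|[s z] [/= ? ?]] //.
    by exists (z, s).
  rewrite -(esum_esum (a := fun z s => (path_prob R (rcons s z) * f z)%:E))//.
  apply: eq_esum => z _; rewrite muleC -esumZl//; last first.
    by move=> s; rewrite lee_fin path_prob_ge0.
  by apply: eq_esum => s _; rewrite -EFinM mulrC.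
rewrite -(@esum_fiber _ _ _ _ [set: nat] size)//; last first.
  by move=> s _; exact: esum_ge0.
have sizeE (n : nat) : \esum_(s in [set s : seq (G * int) | (forall x, x \in s -> A x) /\ size s = n])
    \esum_(z in ~` A) (path_prob R (rcons s z) * f z)%:E
    = (\sum_(v : G) piN R v * exit_at A f n (v, 0))%:E.
  rewrite (_ : [set s | _] = inside n); last first.
    by apply/seteqP; split=> s [].
  (* Length 0 would be an exit at time 0, excluded since the walk starts at level 0, inside [A]. *)
  case: n => [|n].
    rewrite (_ : inside 0 = [set [::]]); last first.
      by apply/seteqP; split=> [s /= [/size0nil ->]|s /= ->].
    rewrite esum_set1; last by apply: esum_ge0.
    rewrite esum1 ?big1// => [v _|z nAz] /=.
      by rewrite asboolT ?mulr0//; apply: A0 => /=.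
    rewrite /path_prob/= /start_law; case: eqP => [z0|_]; last by rewrite mulr0 !mul0r.
    by exfalso; apply: nAz; apply: A0; rewrite /half_cyl/= z0.
  rewrite esum_cons; last by move=> s; exact: esum_ge0.
  rewrite -esum_start_law; last by move=> x; exact: exit_at_ge0.
  rewrite esum_mkcond; apply: eq_esum => y _.
  have [Ay|Ay] := pselect (A y); last by rewrite memNset//= asboolF// mulr0.
  rewrite mem_set//= asboolT// EFinM -esum_walk_weight -esumZl ?start_law_ge0//; last first.
    by move=> s; apply: esum_ge0 => z _; rewrite lee_fin mulr_ge0// walk_weight_ge0.
  apply: eq_esum => s _; rewrite -esumZl ?start_law_ge0//; last first.
    by move=> z; rewrite lee_fin mulr_ge0// walk_weight_ge0.
  by apply: eq_esum => z _; rewrite -EFinM mulrA.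
have e0 n : 0 <= \sum_(v : G) piN R v * exit_at A f n (v, 0).
  by apply: sumr_ge0 => v _; rewrite mulr_ge0 ?exit_at_ge0// /piN divr_ge0.
under eq_esum do rewrite sizeE.
rewrite -nneseries_esumT => [|n]; last by rewrite lee_fin.
apply: lime_le; first by apply: is_cvg_nneseries => n _ _; rewrite lee_fin.
apply: nearW => n; rewrite sumEFin lee_fin.
rewrite big_mkord; apply: le_trans (hB n).
rewrite exchange_big/=; apply: ler_sum => v _.
rewrite exit_byE mulr_sumr [leRHS]big_ord_recr/= lerDl.
by rewrite mulr_ge0 ?exit_at_ge0// /piN divr_ge0.
Qed.

End ExitLaw.

(** * Geometry of clusters *)

Lemma set_maxE (S : set int) m : S m -> ubound S m -> set_max S = m.
Proof.
move=> Sm um; apply: xget_unique => // k [Sk uk].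
by apply/le_anti; rewrite um// uk.
Qed.

Lemma set_max_spec (S : set int) a b : S a -> ubound S b ->
  S (set_max S) /\ ubound S (set_max S).
Proof.
move=> Sa ub; pose P n := `[< S (a + n%:Z) >].
have exP : exists n, P n by exists 0%N; rewrite /P addr0; exact/asboolP.
have bP n : P n -> (n <= `|b - a|)%N by move=> /asboolP/ub; clear; lia.
case: (ex_maxnP exP bP) => n /asboolP Sn nmax.
suff u : ubound S (a + n%:Z) by rewrite (set_maxE Sn u).
move=> k Sk; have [ka|ak] := lerP k a; first by clear -ka; lia.
have : P `|k - a|%N.
  by apply/asboolP; rewrite (_ : a + _ = k)//; clear -ak; lia.
by move=> /nmax; clear -ak; lia.
Qed.

Section Clusters.
Variables (R : realType) (G : graph) (v0 : G).
Implicit Types (A B : set (G * int)) (v : G) (x z : G * int).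

Definition bounded_above A := exists m : int, forall x, A x -> x.2 <= m.

Lemma OmegaP A : Omega A <-> half_cyl 0 `<=` A /\ bounded_above A.
Proof.
split=> [[F [finF ->]]|[A0 [m Am]]].
  split; first exact: subsetUl.
  have [s Fs] := (finite_seqP F).1 finF.
  exists (\sum_(x <- s) `|x.2|%N)%:Z => x [|]; first by rewrite /half_cyl/= => /le_trans; apply.
  rewrite Fs /= => xs; rewrite (big_rem x)//=; clear; lia.
exists (A `&` [set x | 0 < x.2]); split; last first.
  apply/seteqP; split=> x; last by case=> [/A0|[]].
  by move=> Ax; have [|] := lerP x.2 0; [left|right].
apply: (@sub_finite_set _ _ [set (p.1, (p.2 : nat)%:Z) | p in [set: G * 'I_(`|m|.+1)]]).
  move=> [v y] [/Am/= ym /= y0]; have yb : (`|y| < `|m|.+1)%N by clear -ym y0; lia.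
  by exists (v, Ordinal yb) => //=; congr pair; clear -y0; lia.
exact/finite_image/finite_finset.
Qed.

Lemma height_spec A : Omega A ->
  [/\ exists v, A (v, height A), forall x, A x -> x.2 <= height A & 0 <= height A].
Proof.
move=> /OmegaP[A0 [m Am]]; have A00 : A (v0, 0) by exact: A0.
have [| |] := @set_max_spec [set y | exists v, A (v, y)] 0 m; first by exists v0.
  by move=> y [v /Am].
rewrite -/(height A) => hA uA; split=> //.
  by move=> [v y] Ax; apply: uA; exists v.
by apply: uA; exists v0.
Qed.

Lemma heightE A v h : A (v, h) -> (forall x, A x -> x.2 <= h) -> height A = h.
Proof. by move=> Ah uA; apply: set_maxE => [|y [w /uA]//]; exists v. Qed.

Lemma full_level_spec A : Omega A ->
  [/\ 0 <= full_level A, half_cyl (full_level A) `<=` A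
    & forall k, 0 <= k -> half_cyl k `<=` A -> k <= full_level A].
Proof.
move=> /OmegaP[A0 [m Am]].
have [| |] := @set_max_spec [set k | 0 <= k /\ half_cyl k `<=` A] 0 m; first by split.
  by move=> k [k0 kA]; apply: (Am (v0, k)); apply: kA; exact: (lexx k).
by rewrite -/(full_level A) => -[f0 fA] u; split=> // k k0 kA; apply: u.
Qed.

Lemma shiftE A v y : shift A (v, y) = A (v, y + full_level A).
Proof.
apply/propext; split=> [[[w k] Ax [<- <-]]|Ax]; first by rewrite subrK.
by exists (v, y + full_level A) => //=; rewrite addrK.
Qed.

Lemma Omega_shift A : Omega A -> Omega (shift A).
Proof.
move=> OA; have [f0 fA _] := full_level_spec OA; have [_ hA _] := height_spec OA.
apply/OmegaP; split=> [[v y] /= y0|].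
  by rewrite shiftE; apply: fA; rewrite /half_cyl/= -[leRHS]add0r lerD2r.
exists (height A - full_level A) => -[v y]; rewrite shiftE => /hA/=.
by rewrite lerBrDr.
Qed.

Lemma height_shift A : Omega A -> height (shift A) = height A - full_level A.
Proof.
move=> OA; have [[v Av] hA _] := height_spec OA.
apply: (@heightE _ v); first by rewrite shiftE subrK.
by move=> [w y]; rewrite shiftE => /hA/=; rewrite lerBrDr.
Qed.

Lemma full_level_shift A : Omega A -> full_level (shift A) = 0.
Proof.
move=> OA; have [f0 fA fmax] := full_level_spec OA.
have /OmegaP[s0 _] := Omega_shift OA.
have [g0 gA _] := full_level_spec (Omega_shift OA).
apply/le_anti; rewrite g0 andbT -(lerD2r (full_level A)) add0r.
apply: fmax; first exact: addr_ge0.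
move=> [v y] yk; rewrite -[y](subrK (full_level A)) -shiftE.
by apply: gA; rewrite /half_cyl/= lerBlDr.
Qed.

Lemma Omega_add A z : Omega A -> Omega (A `|` [set z]).
Proof.
move=> /OmegaP[A0 [m Am]]; apply/OmegaP; split; first by move=> x /A0; left.
exists (Num.max m z.2) => x [/Am xm|->]; by rewrite le_max ?xm ?lexx ?orbT.
Qed.

Definition depth_holes A (i : nat) : nat := #|level_holes A (height A - i%:Z)|.

(** [t = 1] counts the holes and [t = hole_base] weighs them. Depth is measured from the top, so
    that the sum is invariant under [shift]; levels at depth [height A] or more are full. *)
Definition hole_sum (t : R) A : R :=
  \sum_(i < `|height A|%N) (depth_holes A i)%:R * t ^+ i.

Lemma depth_holes0 A i : Omega A -> (`|height A|%N <= i)%N -> depth_holes A i = 0%N.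
Proof.
move=> OA hi; have [_ _ h0] := height_spec OA; have /OmegaP[A0 _] := OA.
apply/eqP; rewrite cards_eq0; apply/eqP/setP => v; rewrite !inE; apply/negbF/asboolP.
by apply: A0; rewrite /half_cyl/=; clear -hi h0; lia.
Qed.

Lemma hole_sum_widen t A n : Omega A -> (`|height A|%N <= n)%N ->
  hole_sum t A = \sum_(i < n) (depth_holes A i)%:R * t ^+ i.
Proof.
move=> OA hn; rewrite /hole_sum (big_ord_widen n (fun i => (depth_holes A i)%:R * t ^+ i))//.
rewrite big_mkcond; apply: eq_bigr => i _; case: ltnP => // hi.
by rewrite depth_holes0// mul0r.
Qed.

Lemma hole_sum_shift t A : Omega A -> hole_sum t (shift A) = hole_sum t A.
Proof.
move=> OA; have [f0 _ _] := full_level_spec OA; have [_ _ h0] := height_spec OA.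
have [_ _] := height_spec (Omega_shift OA); rewrite height_shift// => s0.
rewrite (@hole_sum_widen _ _ `|height A|%N); last 2 first.
- exact: Omega_shift.
- by rewrite height_shift//; clear -f0 s0; lia.
apply: eq_bigr => i _; congr (_%:R * _); rewrite /depth_holes; congr #|pred_of_set _|.
apply/setP => v; rewrite !inE height_shift// shiftE.
by congr (~~ `[< A (v, _) >]); ring.
Qed.

Lemma hole_sum_add_low t A z : Omega A -> ~ A z -> z.2 <= height A ->
  [/\ height (A `|` [set z]) = height A, (`|height A - z.2| < `|height A|)%N
    & hole_sum t (A `|` [set z]) = hole_sum t A - t ^+ `|height A - z.2|].
Proof.
move=> OA nAz zh; have [[v Av] hA h0] := height_spec OA; have /OmegaP[A0 _] := OA.
have z0 : 0 < z.2 by rewrite ltNge; apply/negP => /A0.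
have hB : height (A `|` [set z]) = height A.
  by apply: (@heightE _ v) => [|x [/hA|->]]; [left|..].
set m := `|height A - z.2|%N.
have mh : (m < `|height A|)%N by rewrite /m; clear -z0 zh; lia.
split=> //; rewrite /hole_sum hB.
have dE (i : nat) : (depth_holes (A `|` [set z]) i)%:R * t ^+ i =
    (depth_holes A i)%:R * t ^+ i - (i == m)%:R * t ^+ i.
  rewrite -mulrBl; congr (_ * _); rewrite /depth_holes hB.
  case: (eqVneq i m) => [->|im].
    have -> : height A - m%:Z = z.2 by rewrite /m; clear -zh; lia.
    rewrite (cardsD1 z.1 (level_holes A _)) inE asboolF; last by rewrite -surjective_pairing.
    rewrite natrD addrAC subrr add0r; congr (#|pred_of_set _|%:R).
    apply/setP => w; rewrite !inE; case: (eqVneq w z.1) => [->|wz] /=.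
      by apply/negbF/asboolP; right; rewrite -surjective_pairing.
    congr (~~ _); apply: asbool_equiv_eq; split=> [[//|zw]|]; last by left.
    by move: wz; rewrite -zw eqxx.
  rewrite subr0; congr (#|pred_of_set _|%:R); apply/setP => w; rewrite !inE.
  congr (~~ _); apply: asbool_equiv_eq; split=> [[//|zw]|]; last by left.
  by exfalso; move/eqP: im; apply; rewrite /m -zw/=; clear; lia.
under eq_bigr do rewrite dE.
rewrite sumrB; congr (_ - _); rewrite (bigD1 (Ordinal mh))//= eqxx mul1r big1 ?addr0// => i.
by rewrite -val_eqE/= => /negbTE ->; rewrite mul0r.
Qed.

Lemma hole_sum_add_top t A z : Omega A -> z.2 = height A + 1 ->
  height (A `|` [set z]) = height A + 1
  /\ hole_sum t (A `|` [set z]) = #|G|%:R - 1 + t * hole_sum t A.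
Proof.
move=> OA zh; have [_ hA h0] := height_spec OA.
have hB : height (A `|` [set z]) = height A + 1.
  apply: (@heightE _ z.1) => [|x [/hA|->]]; first by right; rewrite -zh -surjective_pairing.
    by clear; lia.
  by rewrite zh.
split=> //; rewrite /hole_sum hB.
have -> : `|(height A + 1)%R|%N = (`|height A|%N).+1 by clear -h0; lia.
rewrite big_ord_recl/= expr0 mulr1; congr (_ + _).
  rewrite /depth_holes hB subr0.
  have -> : level_holes (A `|` [set z]) (height A + 1) = [set~ z.1]%SET.
    apply/setP => w; rewrite !inE; congr (~~ _); apply/asboolP/eqP => [[/hA/=|/=]|->].
    - by clear; lia.
    - by move=> <-.
    - by right; rewrite -zh -surjective_pairing.
  rewrite cardsC1 -subn1 natrB//; apply/card_gt0P; by exists v0.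
rewrite mulr_sumr; apply: eq_bigr => i _; rewrite /bump/= add1n exprS mulrCA; congr (_ * (_ * _)).
rewrite /depth_holes hB; congr (#|pred_of_set _|%:R); apply/setP => w; rewrite !inE.
have -> : height A + 1 - i.+1%:Z = height A - i%:Z by clear; lia.
congr (~~ _); apply: asbool_equiv_eq; split=> [[//|zw]|]; last by left.
by exfalso; move: zh; rewrite -zw/=; clear; lia.
Qed.

Lemma deep_hole A : Omega A -> full_level A = 0 -> 0 < height A ->
  (0 < depth_holes A `|height A|.-1)%N.
Proof.
move=> OA f0 h0; have [_ _ fmax] := full_level_spec OA; have /OmegaP[A0 _] := OA.
have h1 : height A - (`|height A|.-1)%:Z = 1 by clear -h0; lia.
rewrite /depth_holes h1 lt0n cards_eq0; apply/negP => /eqP e.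
suff : (1 : int) <= full_level A by rewrite f0.
apply: fmax => // -[v y]; rewrite /half_cyl/= => y1.
have [y0|y0] := lerP y 0; first exact: A0.
have -> : y = 1 by clear -y0 y1; lia.
by apply: contrapT => nA; have : v \in level_holes A 1; [rewrite inE asboolF | rewrite e inE].
Qed.

End Clusters.

(** * Stationarity *)

Section EsumMore.
Variable R : realType.
Local Open Scope ereal_scope.

Lemma esum_exchange (T1 T2 : choiceType) (X : set T1) (Y : set T2)
    (a : T1 -> T2 -> \bar R) : (forall x y, 0 <= a x y) ->
  \esum_(x in X) \esum_(y in Y) a x y = \esum_(y in Y) \esum_(x in X) a x y.
Proof.
move=> a0; rewrite !esum_esum//.
rewrite (@reindex_esum _ _ _ (Y `*`` (fun=> X)) _ (fun p => (p.2, p.1)))//.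
split=> [[y x] [/= ? ?]|[y x] [y' x'] _ _ [-> ->]|[x y] [/= ? ?]] //.
by exists (y, x).
Qed.

Lemma esumZl_on (T : choiceType) (X : set T) (a : T -> \bar R) (c : R) :
  (0 <= c)%R -> (forall x, X x -> 0 <= a x) ->
  \esum_(x in X) (c%:E * a x) = c%:E * \esum_(x in X) a x.
Proof.
move=> c0 a0; rewrite esum_mkcond [in RHS]esum_mkcond -esumZl//; last first.
  by move=> x; case: ifPn => // /set_mem; exact: a0.
by apply: eq_esum => x _; case: ifP; rewrite ?mule0.
Qed.

Lemma esum_ge_term (T : choiceType) (X : set T) (a : T -> \bar R) x :
  X x -> a x <= \esum_(i in X) a i.
Proof.
move=> Xx; apply: esum_ge; exists [set x]; last by rewrite fsbig_set1.
by split=> // y ->.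
Qed.

End EsumMore.

Section Stationary.
Variables (R : realType) (G : graph) (v0 : G) (mu : set (G * int) -> R).
Implicit Types (A B C : set (G * int)) (z : G * int).
Hypothesis mu_stat : shifted_idla_stationary mu.

Let mu0 A : Omega A -> 0 <= mu A. Proof. exact: mu_stat.1.1. Qed.

Lemma idla_step_ge0 A B : (0 <= idla_step R A B)%E.
Proof. by apply: esum_ge0 => z _; exact: exit_law_ge0. Qed.

Lemma idla_law_ge0 t A B : (0 <= idla_law R t A B)%E.
Proof.
elim: t A B => [|t IH] A B /=; first by case: asboolP.
by apply: esum_ge0 => C _; rewrite mule_ge0// idla_step_ge0.
Qed.

Lemma shifted_law_ge0 t A B : (0 <= shifted_law R t A B)%E.
Proof. by apply: esum_ge0 => C _; exact: idla_law_ge0. Qed.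

Lemma idla_law1 A B : Omega A -> idla_law R 1 A B = idla_step R A B.
Proof.
move=> OA /=; rewrite (esumID [set A])/=; last first.
  by move=> C _; rewrite mule_ge0 ?idla_step_ge0//; case: asboolP.
rewrite (_ : @Omega G `&` [set A] = [set A]); last first.
  by apply/seteqP; split=> [C []//|C ->].
rewrite esum_set1 asboolT// ?mul1e ?idla_step_ge0// esum1 ?adde0// => C [_ /= AC].
by rewrite asboolF ?mul0e// => /esym.
Qed.

Lemma shifted_law1 A (f : set (G * int) -> R) : Omega A -> (forall B, 0 <= f B) ->
  (\esum_(B in @Omega G) (shifted_law R 1 A B * (f B)%:E)
  = \esum_(z in ~` A) (exit_law R A z * (f (shift (A `|` [set z])))%:E))%E.
Proof.
move=> OA f0.
have e0 z B : (0 <= exit_law R A z * (f B)%:E)%E by rewrite mule_ge0 ?exit_law_ge0 ?lee_fin.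
have i0 B C : (0 <= idla_step R A B * (f C)%:E)%E by rewrite mule_ge0 ?idla_step_ge0 ?lee_fin.
rewrite -[RHS](@esum_fiber _ _ _ _ (@Omega G) (fun z => A `|` [set z])); last 2 first.
- by move=> z _; exact: Omega_add.
- by move=> z _; exact: e0.
rewrite [RHS](eq_esum (b := fun C => idla_step R A C * (f (shift C))%:E)%E); last first.
  move=> C _; rewrite muleC -esumZl//; last by move=> z; exact: exit_law_ge0.
  by apply: eq_esum => z [_ ->]; rewrite muleC.
rewrite -[RHS](@esum_fiber _ _ _ (@Omega G) (@Omega G) (fun C => shift C)); last 2 first.
- by move=> C; exact: (Omega_shift v0).
- by move=> C _; exact: i0.
apply: eq_esum => B _; rewrite muleC -esumZl//; last by move=> C; exact: idla_law_ge0.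
by apply: eq_esum => C [_ <-]; rewrite idla_law1// muleC.
Qed.

Lemma stationary_integral (f : set (G * int) -> R) : (forall B, 0 <= f B) ->
  (\esum_(B in @Omega G) (mu B * f B)%:E = \esum_(A in @Omega G) ((mu A)%:E *
     \esum_(z in ~` A) (exit_law R A z * (f (shift (A `|` [set z])))%:E)))%E.
Proof.
(* The values of [mu] outside [Omega] may be negative; [m] makes all terms nonnegative for the
   exchange of sums. *)
move=> f0; pose m A := if `[< Omega A >] then mu A else 0.
have m0 A : 0 <= m A by rewrite /m; case: asboolP => // /mu0.
have mE A : Omega A -> mu A = m A by move=> OA; rewrite /m asboolT.
rewrite (eq_esum (b := fun B => \esum_(A in @Omega G)
    ((f B)%:E * ((m A)%:E * shifted_law R 1 A B)))%E); last first.
  move=> B OB; rewrite mulrC EFinM -(mu_stat.2 1%N B OB) esumZl//; last first.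
    by move=> A; rewrite mule_ge0 ?lee_fin ?shifted_law_ge0.
  by congr (_ * _)%E; apply: eq_esum => A OA; rewrite mE.
rewrite esum_exchange; last first.
  by move=> A B; rewrite !mule_ge0 ?lee_fin ?shifted_law_ge0.
apply: eq_esum => A OA; rewrite mE// -shifted_law1// -esumZl//; last first.
  by move=> B; rewrite mule_ge0 ?lee_fin ?shifted_law_ge0.
by apply: eq_esum => B _; rewrite muleCA [(_ * (f B)%:E)%E]muleC.
Qed.

(** After one step the shifted process sits at some [shift C], whose full level is 0. *)
Lemma charged_reduced A : Omega A -> mu A != 0 -> full_level A = 0.
Proof.
move=> OA; apply: contraNeq => fA; have := mu_stat.2 1%N A OA.
rewrite esum1; first by move=> [->].
move=> B OB; rewrite [shifted_law _ _ _ _]esum1 ?mule0// => C [OC CA].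
by exfalso; move/eqP: fA; apply; rewrite -CA (full_level_shift v0).
Qed.

Hypothesis exit_le1 : forall A, Omega A -> (\esum_(z in ~` A) exit_law R A z <= 1)%E.

(** Integrating the constant 1 shows that the exit masses have [mu]-mean 1; since none exceeds 1, a
    charged cluster with a smaller one would lower the mean. *)
Lemma charged_exit_mass A : Omega A -> mu A != 0 ->
  (\esum_(z in ~` A) exit_law R A z = 1)%E.
Proof.
move=> OA muA.
pose nu A := (\esum_(z in ~` A) exit_law R A z)%E.
have nu0 B : (0 <= nu B)%E by apply: esum_ge0 => z _; exact: exit_law_ge0.
have mA : 0 < mu A by rewrite lt_neqAle eq_sym muA mu0.
apply/eqP; rewrite -/(nu A) eq_le exit_le1//= leNgt; apply/negP => nuA.
have tot : (\esum_(B in @Omega G) ((mu B)%:E * nu B) = 1)%E.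
  have := @stationary_integral (fun=> 1) (fun=> ler01).
  rewrite (eq_esum (b := fun B => (mu B)%:E)) ?mu_stat.1.2; last by move=> B _; rewrite mulr1.
  move=> {1}->; apply: eq_esum => B _; congr (_ * _)%E.
  by apply: eq_esum => z _; rewrite mule1.
have one := mu_stat.1.2.
rewrite (esumID [set A]) in one; last by move=> B OB; rewrite lee_fin mu0.
rewrite (esumID [set A]) in tot; last by move=> B OB; rewrite mule_ge0 ?lee_fin ?mu0.
have sI : @Omega G `&` [set A] = [set A] by apply/seteqP; split=> [C []//|C ->].
rewrite sI esum_set1 in one; last by rewrite lee_fin mu0.
rewrite sI esum_set1 in tot; last by rewrite mule_ge0 ?lee_fin ?mu0.
have rest : (\esum_(B in @Omega G `&` ~` [set A]) ((mu B)%:E * nu B)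
    <= \esum_(B in @Omega G `&` ~` [set A]) (mu B)%:E)%E.
  by apply: le_esum => B [OB _]; rewrite -[leRHS]mule1 lee_pmul ?lee_fin ?mu0 ?exit_le1.
have r0 : (0 <= \esum_(B in @Omega G `&` ~` [set A]) (mu B)%:E)%E.
  by apply: esum_ge0 => B [OB _]; rewrite lee_fin mu0.
have nuf : ((mu A)%:E * nu A < (mu A)%:E)%E by rewrite -[ltRHS]mule1 lte_pmul2l ?lte_fin.
move: one tot rest r0; set r := esum _ _; set r' := esum _ _.
case: r => [r| |] //.
move=> one tot rest r0.
have : ((mu A)%:E * nu A + r' < 1)%E.
  rewrite -one; apply: lte_leD => //; rewrite ge0_fin_numE ?(le_lt_trans rest) ?ltry//.
  by apply: esum_ge0 => B [OB _]; rewrite mule_ge0 ?lee_fin ?mu0.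
by rewrite tot ltxx.
Qed.

(* Truncating at [K] makes the integrals finite, so that they cancel. *)
Lemma lyapunov_tail (U : set (G * int) -> R) (k b M : R) :
  (forall A, 0 <= U A) -> 0 < k <= 1 -> 0 <= b -> 0 < M ->
  (forall A K, Omega A -> mu A != 0 -> 0 <= K ->
    (\esum_(z in ~` A) (exit_law R A z * (Num.min (U (shift (A `|` [set z]))) K)%:E)
      <= (Num.min ((1 - k) * U A + b) K)%:E)%E) ->
  (Omega_prob mu [set A | (M <= U A)%R] <= (b / (k * M))%:E)%E.
Proof.
move=> U0 /andP[k0 k1] b0 M0 drift; apply: ge_ereal_sup => _ [F [finF FE] <-].
have [s Fs] := (finite_seqP F).1 finF.
(* Large enough for the event [M <= U <= K] to contain the finite set [F]; the final bound does not
   involve [K]. *)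
pose K := \sum_(A <- s) U A.
have K0 : 0 <= K by apply: sumr_ge0.
have FK A : F A -> U A <= K.
  by rewrite Fs /= => As; rewrite /K (big_rem A)//= lerDl sumr_ge0.
pose f A := Num.min (U A) K; pose g A := Num.min ((1 - k) * U A + b) K.
pose E := @Omega G `&` [set A | M <= U A <= K].
have f0 A : 0 <= f A by rewrite le_min U0.
pose ind A : R := `[< M <= U A <= K >]%:R.
(* Up to the constant [b], the drift gains [k * U A >= k * M] on the event; where [U A > K] the left
   side is at most [K = f A]. *)
have gf A : g A + k * M * ind A <= f A + b.
  rewrite /g /f /ind; case: asboolP => [/andP[MU UK]|_]; rewrite /= ?mulr1 ?mulr0 ?addr0.
    rewrite (min_l UK); have : Num.min ((1 - k) * U A + b) K <= (1 - k) * U A + b.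
      by rewrite ge_min lexx.
    by have : k * M <= k * U A by [rewrite ler_pM2l]; lra.
  have kU : 0 <= k * U A by rewrite mulr_ge0// ltW.
  have [UK|KU] := leP (U A) K; rewrite ge_min; apply/orP; [left|right]; lra.
have X_le : (\esum_(A in @Omega G) (mu A * f A)%:E <= \esum_(A in @Omega G) (mu A * g A)%:E)%E.
  rewrite stationary_integral//; apply: le_esum => A OA.
  have [->|muA] := eqVneq (mu A) 0; first by rewrite mul0e mul0r.
  by rewrite EFinM lee_pmul2l ?drift// lte_fin lt_neqAle eq_sym muA mu0.
have esum_mu c : 0 <= c -> (\esum_(A in @Omega G) (mu A * c)%:E = c%:E)%E.
  move=> c0; rewrite -[RHS]mule1 -mu_stat.1.2 -esumZl_on//.
  by apply: eq_esum => A _; rewrite -EFinM mulrC.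
have X_fin h : (forall A, 0 <= h A) -> (forall A, h A <= K) ->
    (\esum_(A in @Omega G) (mu A * h A)%:E)%E \is a fin_num.
  move=> h0 hK; rewrite ge0_fin_numE; last first.
    by apply: esum_ge0 => A OA; rewrite lee_fin mulr_ge0// mu0.
  apply: le_lt_trans (ltry K); rewrite -(esum_mu K K0); apply: le_esum => A OA.
  by rewrite lee_fin ler_wpM2l// mu0.
have fK A : f A <= K by rewrite /f ge_min lexx orbT.
have gK A : g A <= K by rewrite /g ge_min lexx orbT.
have g0 A : 0 <= g A.
  by rewrite /g le_min K0 andbT addr_ge0// mulr_ge0// subr_ge0.
have ind0 A : 0 <= k * M * ind A by rewrite !mulr_ge0// ltW.
have : (\esum_(A in @Omega G) (mu A * g A)%:E
    + \esum_(A in @Omega G) (mu A * (k * M * ind A))%:E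
    <= \esum_(A in @Omega G) (mu A * g A)%:E + b%:E)%E.
  rewrite -esumD; [|by move=> A OA; rewrite lee_fin mulr_ge0 ?mu0..].
  apply: (@le_trans _ _ (\esum_(A in @Omega G) (mu A * f A)%:E + b%:E)%E); last first.
    by rewrite leeD2r.
  rewrite -(esum_mu b b0) -esumD; [|by move=> A OA; rewrite lee_fin mulr_ge0 ?mu0..].
  by apply: le_esum => A OA; rewrite -!EFinD -!mulrDr lee_fin ler_wpM2l ?mu0.
rewrite leeD2lE; last exact: X_fin.
have indE : (\esum_(A in @Omega G) (mu A * (k * M * ind A))%:E
    = (k * M)%:E * \esum_(A in E) (mu A)%:E)%E.
  rewrite /E esum_mkcondr -esumZl_on ?mulr_ge0 ?(ltW k0) ?(ltW M0)//; last first.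
    by move=> A OA; case: ifP => // _; rewrite lee_fin mu0.
  apply: eq_esum => A OA; rewrite /ind; case: asboolP => MU.
    by rewrite mem_set// -EFinM mulr1 mulrC.
  by rewrite memNset// mule0 !mulr0.
rewrite indE -lee_pdivlMl ?mulr_gt0// -EFinM => h; rewrite mulrC.
apply: le_trans h; apply: ereal_sup_ubound; exists F => //; split=> // A FA.
by have [OA /= MA] := FE A FA; split=> //=; rewrite MA FK.
Qed.

End Stationary.

(** * The level of the exit point *)

Section ExitLevels.
Variables (R : realType) (G : graph) (v0 : G).
Implicit Types (A : set (G * int)) (z : G * int).
Hypothesis pi_gt0 : forall v : G, 0 < piN R v.

Lemma exit_law_le1 A : Omega A -> (\esum_(z in ~` A) exit_law R A z <= 1)%E.
Proof.
move=> /OmegaP[A0 _].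
rewrite (eq_esum (b := fun z => exit_law R A z * 1%:E)%E); last by move=> z _; rewrite mule1.
apply: (@exit_law_le _ _ _ (fun=> 1)) => // n.
apply: (pi_mean_le pi_gt0 v0) => v; apply: exit_by_le_super => // x _.
by rewrite (cyl_op1 pi_gt0).
Qed.

(** The indicator of the levels above [height A + 1] vanishes on [A] and at all neighbours of [A],
    hence is superharmonic on [A], and it is 0 at the starting points. *)
Lemma exit_law_high A z : Omega A -> height A + 1 < z.2 -> exit_law R A z = 0%E.
Proof.
move=> OA hz; have [_ hA h0] := height_spec v0 OA; have /OmegaP[A0 _] := OA.
pose f (x : G * int) : R := (height A + 1 < x.2)%R%:R.
have f0 x : 0 <= f x by rewrite /f ler0n.
have : (\esum_(z in ~` A) (exit_law R A z * (f z)%:E) <= 0%:E)%E.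
  apply: exit_law_le => // n; apply: (pi_mean_le pi_gt0 v0) => v.
  apply: (@le_trans _ _ (f (v, 0))).
    apply: exit_by_le_super => // x /hA xh; rewrite /cyl_op /f big1 => [|w _].
      have -> : (height A + 1 < x.2 + 1) = false by apply/negbTE; rewrite -leNgt; clear -xh; lia.
      have -> : (height A + 1 < x.2 - 1) = false by apply/negbTE; rewrite -leNgt; clear -xh; lia.
      by rewrite !mulr0 !addr0 mulr0 ler0n.
    have -> : (height A + 1 < x.2) = false by apply/negbTE; rewrite -leNgt; clear -xh; lia.
    by rewrite mulr0.
  rewrite /f; have -> // : (height A + 1 < 0) = false by apply/negbTE; rewrite -leNgt; clear -h0; lia.
have nAz : (~` A) z by move=> /hA; clear -hz; lia.
move=> le0; apply/eqP; rewrite eq_le exit_law_ge0 andbT; apply: le_trans le0.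
have := @esum_ge_term _ _ (~` A) (fun z => exit_law R A z * (f z)%:E)%E z nAz.
by rewrite /f hz mule1.
Qed.

(** Off by one from the depth of holes: 0 is the level just above the top, and [i.+1] the level of
    [depth_holes A i]. *)
Definition exit_depth A z : nat := `|(height A + 1 - z.2)%R|%N.

Lemma exit_depth_le A z : Omega A -> ~ A z -> z.2 <= height A + 1 ->
  (exit_depth A z <= `|height A|)%N.
Proof.
move=> /[dup] OA /OmegaP[A0 _] nAz hz; have [_ _ h0] := height_spec v0 OA.
have z0 : 0 < z.2 by rewrite ltNge; apply/negP => /A0.
rewrite /exit_depth; clear -hz h0 z0; lia.
Qed.

Variable N : nat.
Hypothesis cardG : #|G| = N.
Variable delta : R.
Hypothesis delta0 : 0 < delta.
Hypothesis pi_ge : forall v : G, delta / N%:R <= piN R v.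
Variables (K L : nat) (s th lam : R).
Hypothesis minor : forall j (v w : G), (K <= j)%N -> piN R w / 4 <= lazy_law R j v w.
Hypothesis s01 : 0 <= s <= 1.
Hypothesis th0 : 0 <= th.
Hypothesis thsK : th * s ^+ K = 1.
Hypothesis lam01 : 0 <= lam <= 1.
Hypothesis thlam : th * lam ^+ L <= 2^-1.
Hypothesis lam_sub : 4^-1 * (lam ^+ 2 + 1) + 2^-1 * s * lam <= lam.
Hypothesis L1 : (1 <= L)%N.

Lemma exit_levels A : Omega A -> (\esum_(z in ~` A) exit_law R A z = 1)%E ->
  exists p : nat -> R, [/\ forall i, 0 <= p i,
    \sum_(i < `|height A|.+1) p i = 1,
    forall j, (j <= `|height A|)%N -> \sum_(i < j.+1) p i <=
      expR (- (delta / 8 / L%:R * (\sum_(i < `|height A|) (depth_holes A i)%:R / N%:R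
        - \sum_(i < j) (depth_holes A i)%:R / N%:R)))
  & forall g : nat -> R, (forall i, 0 <= g i) ->
    (\esum_(z in ~` A) (exit_law R A z * (g (exit_depth A z))%:E)
      = (\sum_(i < `|height A|.+1) p i * g i)%:E)%E].
Proof.
move=> OA mass; have [_ hA h0] := height_spec v0 OA; have /OmegaP[A0 _] := OA.
set n := `|height A|%N.
have hn : height A = n%:Z by rewrite /n; clear -h0; lia.
pose P i := (\esum_(z in ~` A) (exit_law R A z * (exit_depth A z == i)%:R%:E))%E.
have e0 z (c : R) : 0 <= c -> (0 <= exit_law R A z * c%:E)%E.
  by move=> c0; rewrite mule_ge0 ?exit_law_ge0 ?lee_fin.
have P0 i : (0 <= P i)%E by apply: esum_ge0 => z _; exact: e0.
have P1 i : (P i <= 1)%E.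
  rewrite -mass; apply: le_esum => z _; rewrite -[leRHS]mule1.
  by rewrite lee_wpmul2l ?exit_law_ge0// lee_fin lern1 leq_b1.
have PE i : P i = (fine (P i))%:E.
  by rewrite fineK// ge0_fin_numE// (le_lt_trans (P1 i))// ltry.
have intE g : (forall i, 0 <= g i) ->
    (\esum_(z in ~` A) (exit_law R A z * (g (exit_depth A z))%:E)
      = (\sum_(i < n.+1) fine (P i) * g i)%:E)%E.
  move=> g0; rewrite -sumEFin.
  rewrite [RHS](eq_bigr (fun i : 'I_n.+1 => \esum_(z in ~` A)
      ((g i)%:E * (exit_law R A z * (exit_depth A z == i)%:R%:E))%E)); last first.
    by move=> i _; rewrite mulrC EFinM -PE esumZl// => z; exact: e0.
  rewrite -esum_sum; last first.
    by move=> z i _ _; rewrite mule_ge0 ?lee_fin// e0.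
  apply: eq_esum => z nAz; have [hz|hz] := leP z.2 (height A + 1); last first.
    by rewrite exit_law_high// mul0e big1// => i _; rewrite mul0e mule0.
  have zn := exit_depth_le OA nAz hz.
  have : (exit_depth A z < n.+1)%N by [].
  move: (exit_depth A z) (exit_law R A z) => d e dn.
  rewrite (bigD1 (Ordinal dn))//= big1 => [|i]; last first.
    by rewrite -val_eqE/= eq_sym => /negbTE ->; rewrite mule0 mule0.
  by rewrite eqxx mule1 adde0 muleC.
exists (fun i => fine (P i)); split=> //.
- by move=> i; rewrite -lee_fin -PE.
- apply: EFin_inj; rewrite -mass; have := intE (fun=> 1) (fun=> ler01).
  under eq_bigr do rewrite mulr1.
  by move=> <-; apply: eq_esum => z _; rewrite mule1.
(* An exit depth at most [j] is a level at least [Y]. The levels from 1 to [n - j] below it are, in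
   reverse order, the depths from [j] to [n - 1]. *)
move=> j jn; pose Y := (n - j).+1.
have := intE (fun i => (i <= j)%N%:R) (fun i => ler0n _ _).
have -> : \sum_(i < n.+1) fine (P i) * (i <= j)%N%:R = \sum_(i < j.+1) fine (P i).
  rewrite (big_ord_widen n.+1 (fun i => fine (P i)))// [RHS]big_mkcond.
  by apply: eq_bigr => i _; rewrite ltnS; case: leqP; rewrite ?mulr1 ?mulr0.
move=> intj; rewrite -lee_fin -intj.
pose f (x : G * int) : R := (Y%:Z <= x.2)%R%:R.
apply: (@le_trans _ _ (\esum_(z in ~` A) (exit_law R A z * (f z)%:E))%E).
  apply: le_esum => z nAz; have [hz|hz] := leP z.2 (height A + 1); last first.
    by rewrite exit_law_high// !mul0e.
  rewrite lee_wpmul2l ?exit_law_ge0// lee_fin ler_nat.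
  have [zj|//] := leqP (exit_depth A z) j.
  suff -> : (Y%:Z <= z.2)%R by [].
  by move: zj hz jn; rewrite /exit_depth hn /Y; move: (n) (z.2) => m y; clear; lia.
apply: exit_law_le => // k; have := exit_above_le pi_gt0 cardG delta0 pi_ge A Y k minor s01 th0 thsK
  lam01 thlam lam_sub L1 v0.
move=> /le_trans; apply; rewrite ler_expR lerN2 ler_wpM2l//.
  by rewrite !divr_ge0// ltW.
rewrite le_eqVlt; apply/orP; left; apply/eqP.
have -> : \sum_(i < n) (depth_holes A i)%:R / N%:R
    - \sum_(i < j) (depth_holes A i)%:R / N%:R
    = \sum_(i < n - j) (depth_holes A (j + i))%:R / N%:R :> R.
  rewrite -!(big_mkord xpredT (fun i => (depth_holes A i)%:R / N%:R)).
  rewrite [X in X - _](@big_cat_nat _ _ _ j)//= addrAC subrr add0r.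
  by rewrite -{1}[j]add0n big_addn big_mkord; apply: eq_bigr => i _; rewrite addnC.
rewrite (reindex_inj rev_ord_inj)/=; apply: eq_bigr => i _.
rewrite /hole_density /depth_holes hn; congr (#|pred_of_set (level_holes _ _)|%:R / _).
by have := ltn_ord i; clear -jn; lia.
Qed.

End ExitLevels.

(** * The height under the stationary law *)

Section HeightTail.
Variables (R : realType) (G : graph) (v0 : G).
Implicit Types (A : set (G * int)) (z : G * int).
Hypothesis pi_gt0 : forall v : G, 0 < piN R v.
Variable N : nat.
Hypothesis cardG : #|G| = N.
Hypothesis N8 : 8 <= N%:R :> R.
Variable delta : R.
Hypothesis delta0 : 0 < delta.
Hypothesis pi_ge : forall v : G, delta / N%:R <= piN R v.
Variables (K L : nat) (s th lam : R).
Hypothesis minor : forall j (v w : G), (K <= j)%N -> piN R w / 4 <= lazy_law R j v w.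
Hypothesis s01 : 0 <= s <= 1.
Hypothesis th0 : 0 <= th.
Hypothesis thsK : th * s ^+ K = 1.
Hypothesis lam01 : 0 <= lam <= 1.
Hypothesis thlam : th * lam ^+ L <= 2^-1.
Hypothesis lam_sub : 4^-1 * (lam ^+ 2 + 1) + 2^-1 * s * lam <= lam.
Hypothesis L1 : (1 <= L)%N.

Let ap := delta / 8 / L%:R.
Let NR : R := N%:R.
Let r := hole_base NR ap.

Let ap0 : 0 < ap. Proof. by rewrite !divr_gt0// ltr0n. Qed.
Let ap8 : ap <= 8^-1.
Proof.
have d1 := delta_le1 pi_gt0 cardG pi_ge v0.
rewrite /ap ler_pdivrMr ?ltr0n//.
have : 1 <= L%:R :> R by rewrite ler1n.
by lra.
Qed.
Let r1 : 1 <= r.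
Proof.
have := hole_base_gt NR ap; have := hole_rate_gt0 N8 ap0; rewrite -/NR -/r; lra.
Qed.
Let r0 : 0 <= r. Proof. by move: r1; lra. Qed.

(** The factor [r] gives a hole at depth [i] the weight [r ^+ i.+1] that [lyapunov] expects. *)
Definition cluster_lyapunov A : R :=
  lyapunov NR ap (hole_sum 1 A / NR) (r * hole_sum r A).

Lemma hole_sum_ge0 (t : R) A : 0 <= t -> 0 <= hole_sum t A.
Proof. by move=> t0; apply: sumr_ge0 => i _; rewrite mulr_ge0// exprn_ge0. Qed.

Lemma lyapunov_ge0 (D Phi : R) : 0 <= Phi -> 0 <= lyapunov NR ap D Phi.
Proof.
move=> P0; rewrite /lyapunov /hole_pot.
have b0 := sky_weight_ge N8 ap0; have e0 := mix_weight_gt0 N8.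
have N0 : 0 <= NR by move: N8; rewrite /NR; lra.
rewrite mulr_ge0 ?mulr_ge0 ?expR_ge0// addr_ge0 ?ler01//.
  exact: le_trans N0 b0.
by rewrite mulr_ge0 ?expR_ge0// ltW.
Qed.

Lemma cluster_lyapunov_ge0 A : 0 <= cluster_lyapunov A.
Proof. by rewrite lyapunov_ge0// mulr_ge0// hole_sum_ge0. Qed.

Lemma hole_sum_deep A : Omega A -> full_level A = 0 -> 0 < height A ->
  r ^+ `|height A| <= r * hole_sum r A.
Proof.
move=> OA f0 h0; have := deep_hole v0 OA f0 h0.
rewrite /hole_sum; have : (0 < `|height A|)%N by clear -h0; lia.
case: `|height A|%N => // n _ /= dn.
rewrite exprS ler_wpM2l// big_ord_recr/= -[leLHS]add0r lerD//.
  by apply: sumr_ge0 => i _; rewrite mulr_ge0// exprn_ge0.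
by rewrite ler_peMl ?exprn_ge0// ler1n.
Qed.

Lemma cluster_lyapunov_step A z : Omega A -> ~ A z -> z.2 <= height A + 1 ->
  cluster_lyapunov (shift (A `|` [set z])) =
  lyapunov NR ap (hole_sum 1 A / NR - NR^-1 + (exit_depth A z == 0%N)%:R)
   (if exit_depth A z == 0%N then r * (r * hole_sum r A) + (NR - 1) * r
    else r * hole_sum r A - r ^+ exit_depth A z).
Proof.
move=> OA nAz hz; rewrite /cluster_lyapunov !hole_sum_shift//; [|exact: Omega_add..].
have N0 : NR != 0 by rewrite gt_eqF//; move: N8; rewrite /NR; lra.
have [zl|zh] := leP z.2 (height A).
  have [_ _ ->] := hole_sum_add_low v0 (1 : R) OA nAz zl.
  have [_ _ ->] := hole_sum_add_low v0 r OA nAz zl.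
  have -> : exit_depth A z = `|(height A - z.2)%R|.+1%N.
    by rewrite /exit_depth; clear -zl; lia.
  by rewrite /= addr0 expr1n mulrBr -exprS mulrBl div1r.
have zE : z.2 = height A + 1 by clear -hz zh; lia.
have [_ ->] := hole_sum_add_top v0 (1 : R) OA zE.
have [_ ->] := hole_sum_add_top v0 r OA zE.
have -> : exit_depth A z = 0%N by rewrite /exit_depth zE; clear; lia.
rewrite /= cardG -/NR mul1r; congr (lyapunov _ _ _ _); last by ring.
by rewrite !mulrDl mulfV// mulN1r; ring.
Qed.

Lemma cluster_drift A (M : R) : Omega A -> full_level A = 0 ->
  (\esum_(z in ~` A) exit_law R A z = 1)%E -> 0 <= M ->
  (\esum_(z in ~` A) (exit_law R A z *
      (Num.min (cluster_lyapunov (shift (A `|` [set z]))) M)%:E)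
   <= (Num.min ((1 - hole_rate NR ap / NR) * cluster_lyapunov A
        + 4 * log_factor NR) M)%:E)%E.
Proof.
move=> OA f0 mass M0; have [_ _ h0] := height_spec v0 OA.
have [p [p0 p1 tail intE]] := exit_levels v0 pi_gt0 cardG delta0 pi_ge minor s01
  th0 thsK lam01 thlam lam_sub L1 OA mass.
pose n := `|height A|%N.
pose x (i : nat) : R := lyapunov NR ap (hole_sum 1 A / NR - NR^-1 + (i == 0%N)%:R)
   (if i == 0%N then r * (r * hole_sum r A) + (NR - 1) * r
    else r * hole_sum r A - r ^+ i).
(* A cluster with full level 0 has a hole at level 1, whose weight [r ^+ n] exceeds any [r ^+ i]
   that is subtracted. *)
have x0 i : (i <= n)%N -> 0 <= x i.
  move=> hi; apply: lyapunov_ge0; case: (eqVneq i 0%N) => [_|i0].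
    rewrite addr_ge0// mulr_ge0 ?mulr_ge0 ?hole_sum_ge0//.
    by move: N8; rewrite /NR; lra.
  rewrite subr_ge0; apply: le_trans (_ : r ^+ n <= _).
    by rewrite ler_weXn2l.
  by apply: hole_sum_deep => //; move: i0 hi; rewrite /n; clear -h0; lia.
(* Beyond [n], where no exit occurs, [x] may be negative, while [intE] asks for a nonnegative
   function. *)
pose g i : R := if (i <= n)%N then Num.min (x i) M else 0.
have g0 i : 0 <= g i by rewrite /g; case: ifP => // hi; rewrite le_min x0.
rewrite (eq_esum (b := fun z => exit_law R A z * (g (exit_depth A z))%:E)%E); last first.
  move=> z nAz; have [hz|hz] := leP z.2 (height A + 1); last first.
    by rewrite (exit_law_high v0 pi_gt0 OA hz) !mul0e.
  by rewrite cluster_lyapunov_step// /g (exit_depth_le v0).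
rewrite intE// lee_fin.
have drift := @lyapunov_drift R NR ap N8 ap0 ap8 n (fun i => (depth_holes A i)%:R) p
  (fun i => ler0n _ _) p0 p1 tail.
have DE : \sum_(i < n) (depth_holes A i)%:R / NR = hole_sum 1 A / NR.
  by rewrite /hole_sum mulr_suml; apply: eq_bigr => i _; rewrite expr1n mulr1.
have PE : \sum_(i < n) (depth_holes A i)%:R * hole_base NR ap ^+ i.+1 = r * hole_sum r A.
  by rewrite /hole_sum mulr_sumr; apply: eq_bigr => i _; rewrite exprS mulrCA.
rewrite DE PE in drift; rewrite le_min; apply/andP; split.
  apply: le_trans drift; apply: ler_sum => i _; rewrite ler_wpM2l//.
  by rewrite /g -ltnS ltn_ord ge_min lexx.
apply: (@le_trans _ _ (\sum_(i < n.+1) p i * M)); last by rewrite -mulr_suml p1 mul1r.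
apply: ler_sum => i _; rewrite ler_wpM2l// /g; case: ifP => // _.
by rewrite ge_min lexx orbT.
Qed.

Lemma height_tail (mu : set (G * int) -> R) (H : R) :
  shifted_idla_stationary mu -> 0 <= H ->
  (Omega_prob mu [set A | ((height A)%:~R > H)%R]
   <= (8 * log_factor NR ^+ 3 * NR ^+ 2 / ap
        * expR (- (hole_rate NR ap * H)))%:E)%E.
Proof.
move=> mu_stat H0; set a := hole_rate NR ap; set al := log_factor NR.
have a0 : 0 < a := hole_rate_gt0 N8 ap0.
have al8 : 8 <= al := log_factor_ge8 N8.
have aal : a * al = ap := hole_rateM ap N8.
have e0 := mix_weight_gt0 N8; set eps := mix_weight NR in e0.
have N0 : 0 < NR by move: N8; rewrite /NR; lra.
(* On the event [height A > H], the hole at level 1 alone makes the Lyapunov function at least [M].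
   The prefactor of the bound is [4 * al] divided by [(a / NR) * eps]. *)
pose M := eps * expR (a * H).
have M0 : 0 < M by rewrite mulr_gt0// expR_gt0.
have a8 : 8 * a <= ap := hole_rate_le N8 ap0.
have k01 : 0 < a / NR <= 1.
  rewrite divr_gt0//= ler_pdivrMr// mul1r.
  by move: ap8 N8; rewrite -/NR; lra.
have le1 := exit_law_le1 v0 pi_gt0.
have b0 : 0 <= 4 * al by lra.
have := lyapunov_tail v0 mu_stat cluster_lyapunov_ge0 k01 b0 M0.
have drift A (C : R) : Omega A -> mu A != 0 -> 0 <= C -> 
    (\esum_(z in ~` A) (exit_law R A z *
       (Num.min (cluster_lyapunov (shift (A `|` [set z]))) C)%:E)
      <= (Num.min ((1 - a / NR) * cluster_lyapunov A + 4 * al) C)%:E)%E.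
  move=> OA muA C0; apply: cluster_drift => //.
    exact: (charged_reduced v0 mu_stat).
  exact: (charged_exit_mass v0 mu_stat le1).
move=> /(_ drift) tailM.
apply: (@le_trans _ _ (Omega_prob mu [set A | M <= cluster_lyapunov A])).
  rewrite /Omega_prob !esum_mkcondr; apply: le_esum => A OA.
  have [->|muA] := eqVneq (mu A) 0; first by do 2 case: ifP => _.
  have muA0 : (0 <= (mu A)%:E)%E by rewrite lee_fin mu_stat.1.1.
  case: ifPn => [|_]; last by case: ifP.
  move=> /set_mem/= hH; rewrite mem_set//=.
  have f0 := charged_reduced v0 mu_stat OA muA.
  have [_ _ h0] := height_spec v0 OA.
  have hp : 0 < height A by rewrite -(ltr_int R) (le_lt_trans H0).
  have hn : (height A)%:~R = (`|height A|%N)%:R :> R by rewrite natr_absz ger0_norm.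
  apply: (@le_trans _ _ (eps * r ^+ `|height A|)).
    rewrite /M ler_pM2l// /r /hole_base -/a -expRM_natr ler_expR -hn ler_pM2l//.
    exact: ltW.
  apply: lyapunov_ge => //.
  - by rewrite divr_ge0 ?hole_sum_ge0// ltW.
  - exact: exprn_ge0.
  - apply: le_trans (hole_sum_deep OA f0 hp) _; rewrite lerDl.
    by apply: le_trans (sky_weight_ge N8 ap0); exact: ltW.
apply: le_trans tailM _; rewrite lee_fin le_eqVlt; apply/orP; left; apply/eqP.
have epsE : eps = (2 * NR * al)^-1 by [].
rewrite /M epsE -aal expRN.
have ex : expR (a * H) != 0 by rewrite gt_eqF// expR_gt0.
have aln : al != 0 by rewrite gt_eqF//; lra.
move: (expR _) ex => E En0.
by field; rewrite En0 aln !gt_eqF.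
Qed.

End HeightTail.

(** * Choice of the constants *)

Lemma ln_ge1 (R : realType) (x : R) : 4 <= x -> 1 <= ln x.
Proof.
move=> x4; rewrite -[leLHS](@expRK R); rewrite ler_ln ?posrE ?expR_gt0 ?(lt_le_trans _ x4)//.
apply: le_trans x4; have h : 0 <= (2 : R)^-1 <= 2^-1 by rewrite lexx andbT invr_ge0 ler0n.
have := expR_le1D2x h; have := @expR_gt0 R 2^-1.
rewrite (_ : expR 1 = expR 2^-1 * expR 2^-1); first nra.
by rewrite -expRD; congr expR; lra.
Qed.

Theorem theorem1 (R : realType) (delta delta' gamma : R)
    (hdelta : 0 < delta) (hdelta' : 0 < delta') (hgamma : 0 < gamma) :
  exists c : R,
    forall (G : nat -> graph) (mu : forall N : nat, set (G N * int) -> R),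
      (forall N : nat, (1 <= N)%N -> #|G N| = N /\ connected_graph (G N)) ->
      (forall (N : nat) (v : G N), (2 <= N)%N ->
         delta / N%:R <= piN R v <= delta' / N%:R) ->
      (forall N : nat, (2 <= N)%N -> shifted_idla_stationary (mu N)) ->
      exists N0 : nat, forall N : nat, (N0 <= N)%N ->
        (Omega_prob (mu N)
           [set A | (((height A)%:~R : R) >
                      c * Num.sqrt (tauN R (G N)) * (ln (N%:R : R)) ^+ 2)%R]
         <= ((N%:R : R) `^ (- gamma))%:E)%E.
Proof.
pose C : R := 64 * 32 ^+ 3 * 30.
have C65 : 65 <= C.
  have : 1 <= 32 ^+ 3 :> R by rewrite exprn_ege1// ler1n.
  by rewrite /C; lra.
(* The factor [8 / delta] comes from [ap = delta / 8 / L], 30 from [L <= 30 * sqrt tau], 32 from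
   [log_factor <= 32 * ln N], and the 9 pays for the prefactor, at most [N ^ 9]. *)
exists (8 * 30 * 32 * (gamma + 9) / delta) => G mu cardG pi_b mu_stat.
have C0 : 0 <= C / delta + 8 by rewrite addr_ge0// divr_ge0 ?(ltW hdelta)//; lra.
have [N0 /andP[hN0 _]] := nat_ceil C0.
exists N0 => N NN0.
have NC : C / delta + 8 <= N%:R by apply: le_trans hN0 _; rewrite ler_nat.
have Cd0 : 0 <= C / delta by rewrite divr_ge0 ?(ltW hdelta)//; lra.
have N8 : 8 <= N%:R :> R by lra.
have N2 : (2 <= N)%N by rewrite -(ler_nat R); lra.
have [cN conn] := cardG N (ltnW N2).
have pi_ge v : delta / N%:R <= piN R (v : G N) by case/andP: (pi_b N v N2).
have pi_gt0 v : 0 < piN R (v : G N).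
  by apply: lt_le_trans (pi_ge v); rewrite divr_gt0//; lra.
have [v0 _] : exists v, v \in G N by apply/card_gt0P; rewrite cN ltnW.
have d1 := delta_le1 pi_gt0 cN pi_ge v0.
have [k [tauE tv_k k_le]] := tauN_spec pi_gt0 conn cN hdelta pi_ge v0.
have tau1 := tauN_ge1 pi_gt0 conn cN hdelta pi_ge N2.
have k1 : (1 <= k)%N by rewrite -(ler_nat R) -tauE.
have [L [s [th [lam [L1 L_le [s01 th0 thsK] [lam01 thlam lam_sub]]]]]] :=
  block_constants R k1.
have minor j (v w : G N) : (k + k <= j)%N -> piN R w / 4 <= lazy_law R j v w.
  exact: (lazy_law_minor pi_gt0 _ _ tv_k).
set q := Num.sqrt (tauN R (G N)); rewrite -tauE -/q in L_le.
have q0 : 0 <= q := sqrtr_ge0 _.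
set l := ln (N%:R : R); have l1 : 1 <= l by apply: ln_ge1; lra.
have Npos : 0 < N%:R :> R by lra.
have lN : l <= N%:R.
  by have := @expR_ge1Dx R l; rewrite /l lnK ?posrE//; lra.
set c := 8 * 30 * 32 * _ / _.
have c0 : 0 <= c by rewrite divr_ge0 ?mulr_ge0 ?addr_ge0 ?(ltW hgamma) ?(ltW hdelta)//.
have H0 : 0 <= c * q * l ^+ 2 by rewrite mulr_ge0 ?exprn_ge0 ?(le_trans ler01 l1)// mulr_ge0.
have := height_tail v0 pi_gt0 cN N8 hdelta pi_ge minor s01 th0 thsK lam01 thlam
  lam_sub L1 (mu_stat N N2) H0.
move=> /le_trans; apply; rewrite lee_fin.
set ap := delta / 8 / L%:R; set al := log_factor N%:R.
have alE : al = 8 * (1 + 3 * l) by [].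
have L0 : 0 < L%:R :> R by rewrite ltr0n.
have ap0 : 0 < ap by rewrite !divr_gt0.
have q3 : q <= N%:R ^+ 3.
  have Nd : 65 / delta <= N%:R.
    have : 65 / delta <= C / delta by rewrite ler_pM2r ?invr_gt0.
    by lra.
  have N5 : 1 <= N%:R ^+ 5 :> R by rewrite exprn_ege1//; lra.
  have k6 : (k%:R : R) <= N%:R ^+ 6.
    apply: le_trans k_le _.
    have : 65 / delta * N%:R ^+ 5 <= N%:R * N%:R ^+ 5 by rewrite ler_wpM2r//; lra.
    have : 1 <= N%:R ^+ 5 / delta.
      by rewrite ler_pdivlMr// mul1r; lra.
    by rewrite (exprS _ 5); lra.
  rewrite /q tauE -(@ler_pXn2r _ 2)// ?nnegrE ?sqrtr_ge0 ?exprn_ge0// ?(ltW Npos)//.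
  by rewrite sqr_sqrtr// -exprM.
have aH : (gamma + 9) * l <= hole_rate N%:R ap * (c * q * l ^+ 2).
  have alq : al * L%:R <= 30 * 32 * (l * q).
    rewrite alE; have al32 : 8 * (1 + 3 * l) <= 32 * l by lra.
    apply: (@le_trans _ _ (32 * l * (30 * q))); last lra.
    by rewrite ler_pM//; lra.
  have alL : 0 < al * L%:R by rewrite mulr_gt0// alE; lra.
  have -> : hole_rate N%:R ap * (c * q * l ^+ 2)
      = (gamma + 9) * l * (30 * 32 * (l * q)) / (al * L%:R).
    rewrite /hole_rate -/al /ap /c; field.
    by rewrite !gt_eqF// alE; lra.
  rewrite ler_pdivlMr// ler_wpM2l// mulr_ge0//; lra.
have al0 : 0 <= al by rewrite alE; lra.
(* With [al <= 32 * N] and [L <= 30 * N ^ 3] the prefactor is at most [C / delta * N ^ 8], and [N0]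
   was chosen to make [C / delta <= N]. *)
have pref : 8 * al ^+ 3 * N%:R ^+ 2 / ap <= N%:R ^+ 9.
  have al32 : al <= 32 * N%:R by rewrite alE; lra.
  have al3 : al ^+ 3 <= (32 * N%:R) ^+ 3.
    by rewrite lerXn2r ?nnegrE// (le_trans al0).
  have -> : 8 * al ^+ 3 * N%:R ^+ 2 / ap = 64 / delta * (al ^+ 3 * N%:R ^+ 2 * L%:R).
    by rewrite /ap; field; rewrite !gt_eqF.
  have L3 : L%:R <= 30 * N%:R ^+ 3 :> R by lra.
  apply: (@le_trans _ _ (64 / delta * ((32 * N%:R) ^+ 3 * N%:R ^+ 2 * (30 * N%:R ^+ 3)))).
    have N20 : 0 <= N%:R ^+ 2 :> R by rewrite exprn_ge0.
    have d64 : 0 <= 64 / delta by rewrite divr_ge0 ?(ltW hdelta).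
    apply: (ler_wpM2l d64); apply: ler_pM (ltW L0) _ L3.
      by apply: mulr_ge0 N20; rewrite exprn_ge0.
    exact: ler_wpM2r.
  have -> : 64 / delta * ((32 * N%:R) ^+ 3 * N%:R ^+ 2 * (30 * N%:R ^+ 3))
      = C / delta * N%:R ^+ 8.
    by rewrite /C; field; rewrite gt_eqF.
  by rewrite (exprS _ 8) ler_wpM2r ?exprn_ge0//; lra.
rewrite /powR gt_eqF// -/l.
have -> : expR (- gamma * l) = N%:R ^+ 9 * expR (- ((gamma + 9) * l)).
  rewrite -[X in X ^+ 9]lnK ?posrE// -/l -expRM_natl -expRD; congr expR; ring.
have pref0 : 0 <= 8 * al ^+ 3 * N%:R ^+ 2 / ap.
  apply: divr_ge0 (ltW ap0); apply: mulr_ge0 (exprn_ge0 _ (ltW Npos)).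
  by apply: mulr_ge0 (exprn_ge0 _ al0).
apply: ler_pM pref0 (expR_ge0 _) pref _.
by rewrite ler_expR lerN2.
Qed.
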